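(* Let $\mathcal{D}$ and $\mathcal{C}$ be definable additive categories and let $F,G:\mathcal{D}\rightarrow\mathcal{C}$ be two functors which commute with direct products and direct limits (i.e. morphisms of $\mathbb{DEF}$). Let $\tau':F\upharpoonright{\rm Pinj}(\mathcal{D})\rightarrow G\upharpoonright{\rm Pinj}(\mathcal{D})$ be a natural transformation between their restrictions to the full subcategory of pure-injective objects of $\mathcal{D}$. Then there is a unique natural transformation $\tau:F\rightarrow G$ which restricts to $\tau'$. If $\tau'$ is a natural isomorphism then so is $\tau$.
   Context: All categories and functors are additive. For a skeletally small preadditive category $\mathcal{R}$, ${\rm Mod}\mbox{-}\mathcal{R}$ is the category of additive functors $\mathcal{R}^{\rm op}\rightarrow{\bf Ab}$. A definable subcategory of ${\rm Mod}\mbox{-}\mathcal{R}$ is a full subcategory closed under direct products, direct limits and pure subobjects; a category is definable if it is equivalent to a definable subcategory of some ${\rm Mod}\mbox{-}\mathcal{R}$. $\mathbb{DEF}$ is the 2-category of definable categories, functors commuting with direct products and direct limits, and natural transformations. A monomorphism in a definable category $\mathcal{D}$ is pure if some ultrapower of it is split (equivalently, it is pure in ${\rm Mod}\mbox{-}\mathcal{R}$ when $\mathcal{D}$ is embedded there as a definable subcategory). An object is pure-injective if it is injective over the pure monomorphisms of $\mathcal{D}$; ${\rm Pinj}(\mathcal{D})$ is the full subcategory of pure-injective objects. *)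

(* Defs.v *)
From HB Require Import structures.
From mathcomp Require Import all_boot all_algebra boolp classical_sets filter.

Set Implicit Arguments.
Unset Strict Implicit.
Unset Printing Implicit Defensive.
Import GRing.Theory.
Local Open Scope ring_scope.

Local Obligation Tactic := intros; simpl.

(* Size convention.  A "set" is a type in the universe in which carriers of
   abelian groups live: [small] is literally the universe of the carrier of a
   [zmodType].  Categories have objects and morphisms in larger universes; the
   definition of [Ab] below forces these to be strictly larger. *)
Notation small := Type@{Algebra.Zmodule.axioms_.u0}.

(* Being the image of a set suffices, by replacement. *)
Definition is_small (X : Type) : Prop :=
  exists (S : small) (f : S -> X), forall x, exists s, f s = x.

Record preaddcat := PreAddCat {
  ob :> Type;
  hom : ob -> ob -> Type;
  idm : forall x, hom x x;
  cmp : forall x y z, hom y z -> hom x y -> hom x z;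
  hzero : forall x y, hom x y;
  hopp : forall x y, hom x y -> hom x y;
  hadd : forall x y, hom x y -> hom x y -> hom x y;
  cmpA : forall x y z w (h : hom z w) (g : hom y z) (f : hom x y),
    cmp h (cmp g f) = cmp (cmp h g) f;
  cmp1m : forall x y (f : hom x y), cmp (idm y) f = f;
  cmpm1 : forall x y (f : hom x y), cmp f (idm x) = f;
  haddA : forall x y, associative (@hadd x y);
  haddC : forall x y, commutative (@hadd x y);
  hadd0 : forall x y, left_id (@hzero x y) (@hadd x y);
  haddN : forall x y, left_inverse (@hzero x y) (@hopp x y) (@hadd x y);
  cmpDl : forall x y z (g g' : hom y z) (f : hom x y),
    cmp (hadd g g') f = hadd (cmp g f) (cmp g' f);
  cmpDr : forall x y z (g : hom y z) (f f' : hom x y),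
    cmp g (hadd f f') = hadd (cmp g f) (cmp g f')
}.

Arguments hom {p} _ _.
Arguments idm {p} x.
Arguments cmp {p x y z} _ _.
Arguments hzero {p} x y.
Arguments hopp {p x y} _.
Arguments hadd {p x y} _ _.

Notation "g \c f" := (cmp g f) (at level 50, left associativity).

Record functor (A B : preaddcat) := Functor {
  fob :> A -> B;
  fmap : forall x y, hom x y -> hom (fob x) (fob y);
  fmap1 : forall x, fmap (idm x) = idm (fob x);
  fmapM : forall x y z (g : hom y z) (f : hom x y),
    fmap (g \c f) = fmap g \c fmap f;
  fmapD : forall x y (f g : hom x y), fmap (hadd f g) = hadd (fmap f) (fmap g)
}.

Arguments fmap {A B} _ {x y} _.

Record nattrans (A B : preaddcat) (F G : functor A B) := NatTrans {
  nt :> forall x, hom (F x) (G x);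
  ntN : forall x y (f : hom x y), nt y \c fmap F f = fmap G f \c nt x
}.

Lemma nattrans_eq (A B : preaddcat) (F G : functor A B) (s t : nattrans F G) :
  (forall x, s x = t x) -> s = t.
Proof.
case: s t => [s sN] [t tN] /= st.
have e : s = t by apply: functional_extensionality_dep.
by subst t; congr NatTrans; exact: Prop_irrelevance.
Qed.

Definition fid (A : preaddcat) : functor A A :=
  @Functor A A id (fun x y f => f) (fun=> erefl) (fun _ _ _ _ _ => erefl)
    (fun _ _ _ _ => erefl).

Program Definition fcomp (A B C : preaddcat) (G : functor B C)
    (F : functor A B) : functor A C :=
  @Functor A C (fun x => G (F x)) (fun x y f => fmap G (fmap F f)) _ _ _.
Next Obligation. by rewrite !fmap1. Qed.
Next Obligation. by rewrite !fmapM. Qed.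
Next Obligation. by rewrite !fmapD. Qed.

Section Morphisms.
Variable C : preaddcat.

Definition is_iso (x y : C) (f : hom x y) : Prop :=
  exists g : hom y x, g \c f = idm x /\ f \c g = idm y.

Definition isomorphic (x y : C) : Prop := exists f : hom x y, is_iso f.

Definition monic (x y : C) (f : hom x y) : Prop :=
  forall (w : C) (u v : hom w x), f \c u = f \c v -> u = v.

Definition split_mono (x y : C) (f : hom x y) : Prop :=
  exists r : hom y x, r \c f = idm x.

End Morphisms.

Definition is_natiso (A B : preaddcat) (F G : functor A B) (t : nattrans F G) :
  Prop := forall x, is_iso (t x).

Definition naturally_iso (A B : preaddcat) (F G : functor A B) : Prop :=
  exists t : nattrans F G, is_natiso t.

Definition equivalent (A B : preaddcat) : Prop :=
  exists (E : functor A B) (E' : functor B A),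
    naturally_iso (fcomp E' E) (fid A) /\ naturally_iso (fcomp E E') (fid B).

Definition full_sub (C : preaddcat) (P : C -> Prop) : preaddcat :=
  @PreAddCat {x : C | P x} (fun x y => hom (sval x) (sval y))
    (fun x => idm (sval x)) (fun x y z => @cmp C (sval x) (sval y) (sval z))
    (fun x y => hzero (sval x) (sval y))
    (fun x y => @hopp C (sval x) (sval y))
    (fun x y => @hadd C (sval x) (sval y))
    (fun x y z w => @cmpA C (sval x) (sval y) (sval z) (sval w))
    (fun x y => @cmp1m C (sval x) (sval y))
    (fun x y => @cmpm1 C (sval x) (sval y))
    (fun x y => @haddA C (sval x) (sval y))
    (fun x y => @haddC C (sval x) (sval y))
    (fun x y => @hadd0 C (sval x) (sval y))
    (fun x y => @haddN C (sval x) (sval y))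
    (fun x y z => @cmpDl C (sval x) (sval y) (sval z))
    (fun x y z => @cmpDr C (sval x) (sval y) (sval z)).

Definition incl (C : preaddcat) (P : C -> Prop) : functor (full_sub P) C :=
  @Functor (full_sub P) C (fun x => sval x) (fun x y f => f) (fun=> erefl)
    (fun _ _ _ _ _ => erefl) (fun _ _ _ _ => erefl).

Definition frestr (C B : preaddcat) (F : functor C B) (P : C -> Prop) :
  functor (full_sub P) B := fcomp F (incl P).

Definition ntrestr (C B : preaddcat) (F G : functor C B) (t : nattrans F G)
    (P : C -> Prop) : nattrans (frestr F P) (frestr G P) :=
  @NatTrans (full_sub P) B (frestr F P) (frestr G P)
    (fun x => t (sval x)) (fun x y f => @ntN _ _ _ _ t (sval x) (sval y) f).

Definition opcat (C : preaddcat) : preaddcat :=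
  @PreAddCat C (fun x y => hom y x) (fun x => idm x)
    (fun x y z g f => f \c g)
    (fun x y => hzero y x) (fun x y => @hopp C y x) (fun x y => @hadd C y x)
    (fun x y z w h g f => esym (cmpA f g h))
    (fun x y => @cmpm1 C y x) (fun x y => @cmp1m C y x)
    (fun x y => @haddA C y x) (fun x y => @haddC C y x)
    (fun x y => @hadd0 C y x) (fun x y => @haddN C y x)
    (fun x y z g g' f => cmpDr f g g')
    (fun x y z g f f' => cmpDl f f' g).

Section FunctorCategory.
Variables A B : preaddcat.
Implicit Types F G H : functor A B.

Lemma hopp_eq (x y : B) (f g : hom x y) : hadd f g = hzero x y -> f = hopp g.
Proof.
move=> fg; rewrite -[f]hadd0 -(haddN g) -haddA (haddC g) fg haddC.
exact: hadd0.
Qed.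

Lemma haddI (x y : B) (f g h : hom x y) : hadd f g = hadd f h -> g = h.
Proof. by move=> e; rewrite -[g]hadd0 -(haddN f) -haddA e haddA haddN hadd0. Qed.

Lemma cmp0m (x y z : B) (f : hom x y) : hzero y z \c f = hzero x z.
Proof.
by apply: (haddI (f := hzero y z \c f)); rewrite -cmpDl hadd0 haddC hadd0.
Qed.

Lemma cmpm0 (x y z : B) (f : hom y z) : f \c hzero x y = hzero x z.
Proof.
by apply: (haddI (f := f \c hzero x y)); rewrite -cmpDr hadd0 haddC hadd0.
Qed.

Lemma cmpNm (x y z : B) (g : hom y z) (f : hom x y) :
  hopp g \c f = hopp (g \c f).
Proof. by apply: hopp_eq; rewrite -cmpDl haddN cmp0m. Qed.

Lemma cmpmN (x y z : B) (g : hom y z) (f : hom x y) :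
  g \c hopp f = hopp (g \c f).
Proof. by apply: hopp_eq; rewrite -cmpDr haddN cmpm0. Qed.

Program Definition nt_id F : nattrans F F :=
  @NatTrans A B F F (fun x => idm (F x)) _.
Next Obligation. by rewrite cmp1m cmpm1. Qed.

Program Definition nt_comp F G H (t : nattrans G H) (s : nattrans F G) :
  nattrans F H := @NatTrans A B F H (fun x => t x \c s x) _.
Next Obligation. by rewrite -cmpA ntN !cmpA ntN. Qed.

Program Definition nt_zero F G : nattrans F G :=
  @NatTrans A B F G (fun x => hzero (F x) (G x)) _.
Next Obligation. by rewrite cmp0m cmpm0. Qed.

Program Definition nt_opp F G (t : nattrans F G) : nattrans F G :=
  @NatTrans A B F G (fun x => hopp (t x)) _.
Next Obligation. by rewrite cmpNm cmpmN ntN. Qed.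

Program Definition nt_add F G (s t : nattrans F G) : nattrans F G :=
  @NatTrans A B F G (fun x => hadd (s x) (t x)) _.
Next Obligation. by rewrite cmpDl cmpDr !ntN. Qed.

Program Definition funcat : preaddcat :=
  @PreAddCat (functor A B) (@nattrans A B) nt_id nt_comp nt_zero nt_opp nt_add
    _ _ _ _ _ _ _ _ _.
Next Obligation. by apply: nattrans_eq => a /=; rewrite cmpA. Qed.
Next Obligation. by apply: nattrans_eq => a /=; rewrite cmp1m. Qed.
Next Obligation. by apply: nattrans_eq => a /=; rewrite cmpm1. Qed.
Next Obligation. by move=> s t u; apply: nattrans_eq => a /=; rewrite haddA. Qed.
Next Obligation. by move=> s t; apply: nattrans_eq => a /=; rewrite haddC. Qed.
Next Obligation. by move=> s; apply: nattrans_eq => a /=; rewrite hadd0. Qed.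
Next Obligation. by move=> s; apply: nattrans_eq => a /=; rewrite haddN. Qed.
Next Obligation. by apply: nattrans_eq => a /=; rewrite cmpDl. Qed.
Next Obligation. by apply: nattrans_eq => a /=; rewrite cmpDr. Qed.

End FunctorCategory.

Lemma additive_eq (U V : zmodType) (f g : {additive U -> V}) :
  f =1 g -> f = g.
Proof.
case: f g => [f [[f0]]] [g [[g0]]] /= /funext e; subst g.
congr (GRing.Additive.Pack (GRing.Additive.Class _)); congr (_ _).
exact: Prop_irrelevance.
Qed.

Program Definition Ab : preaddcat :=
  @PreAddCat zmodType (fun U V => {additive U -> V})
    (fun U => idfun) (fun U V W g f => g \o f)
    (fun U V => \0 : {additive U -> V})
    (fun U V f => \- f)
    (fun U V f g => f \+ g) _ _ _ _ _ _ _ _ _.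
Next Obligation. by apply: additive_eq. Qed.
Next Obligation. by apply: additive_eq. Qed.
Next Obligation. by apply: additive_eq. Qed.
Next Obligation. by move=> f g h; apply: additive_eq => a /=; rewrite addrA. Qed.
Next Obligation. by move=> f g; apply: additive_eq => a /=; rewrite addrC. Qed.
Next Obligation. by move=> f; apply: additive_eq => a /=; rewrite add0r. Qed.
Next Obligation. by move=> f; apply: additive_eq => a /=; rewrite addNr. Qed.
Next Obligation. by apply: additive_eq. Qed.
Next Obligation. by apply: additive_eq => a /=; rewrite raddfD. Qed.

Definition Mod (R : preaddcat) : preaddcat := funcat (opcat R) Ab.

(* The hom-groups of [R] are sets, and so is its collection of isomorphism
   classes of objects. *)
Definition skeletally_small (R : preaddcat) : Prop :=
  (forall x y : R, is_small (hom x y)) /\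
  exists (S : small) (s : S -> R), forall x, exists i, isomorphic (s i) x.

Definition is_product (C : preaddcat) (I : small) (X : I -> C) (P : C)
    (pr : forall i, hom P (X i)) : Prop :=
  forall (Q : C) (q : forall i, hom Q (X i)),
    exists! h : hom Q P, forall i, pr i \c h = q i.

Definition directed (K : small) (le : K -> K -> Prop) : Prop :=
  [/\ inhabited K, forall k, le k k,
      forall k l m, le k l -> le l m -> le k m &
      forall k l, exists m, le k m /\ le l m].

(* [ds_map] does not depend on the proof of [le k l]: this follows from
   [ds_map1] and [ds_mapM]. *)
Record dirsys (C : preaddcat) (K : small) (le : K -> K -> Prop) := DirSys {
  ds_ob :> K -> C;
  ds_map : forall k l, le k l -> hom (ds_ob k) (ds_ob l);
  ds_map1 : forall k (r : le k k), ds_map r = idm (ds_ob k);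
  ds_mapM : forall k l m (r : le k l) (s : le l m) (t : le k m),
    ds_map s \c ds_map r = ds_map t
}.

Arguments ds_map {C K le} _ {k l} _.

Definition is_cocone (C : preaddcat) (K : small) (le : K -> K -> Prop)
    (S : dirsys C le) (L : C) (inj : forall k, hom (S k) L) : Prop :=
  forall k l (r : le k l), inj l \c ds_map S r = inj k.

(* A direct limit of [S], when [le] is [directed]. *)
Definition is_dirlim (C : preaddcat) (K : small) (le : K -> K -> Prop)
    (S : dirsys C le) (L : C) (inj : forall k, hom (S k) L) : Prop :=
  is_cocone inj /\
  forall (Q : C) (q : forall k, hom (S k) Q), is_cocone q ->
    exists! h : hom L Q, forall k, h \c inj k = q k.

Program Definition fdirsys (B C : preaddcat) (F : functor B C) (K : small)
    (le : K -> K -> Prop) (S : dirsys B le) : dirsys C le :=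
  @DirSys C K le (fun k => F (S k)) (fun k l r => fmap F (ds_map S r)) _ _.
Next Obligation. by rewrite ds_map1 fmap1. Qed.
Next Obligation. by rewrite -fmapM; congr (fmap F _); exact: ds_mapM. Qed.

Definition preserves_products (B C : preaddcat) (F : functor B C) : Prop :=
  forall (I : small) (X : I -> B) (P : B) (pr : forall i, hom P (X i)),
    is_product pr -> is_product (fun i => fmap F (pr i)).

Definition preserves_dirlims (B C : preaddcat) (F : functor B C) : Prop :=
  forall (K : small) (le : K -> K -> Prop), directed le ->
  forall (S : dirsys B le) (L : B) (inj : forall k, hom (S k) L),
    is_dirlim inj ->
    @is_dirlim C K le (fdirsys F S) (F L) (fun k => fmap F (inj k)).

(* The members of an ultrafilter, directed by reverse inclusion. *)
Definition revincl (I : small) (U : set_system I)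
    (J J' : {J : I -> Prop | U J}) : Prop := forall i, sval J' i -> sval J i.

(* An ultrapower of [X] is a direct limit of the powers [X^J] over the members
   [J] of the ultrafilter [U], the transition maps [X^J -> X^J'] for
   [J' `<=` J] being the restrictions. *)
Record ultrapower (C : preaddcat) (I : small) (U : set_system I) (X : C) :=
  Ultrapower {
  up_sys : dirsys C (@revincl I U);
  up_pr : forall (J : {J : I -> Prop | U J}) (i : {i : I | sval J i}),
    hom (up_sys J) X;
  up_prod : forall J : {J : I -> Prop | U J},
    @is_product C {i : I | sval J i} (fun=> X) (up_sys J) (@up_pr J);
  up_restr : forall (J J' : {J : I -> Prop | U J}) (r : revincl J J') i
      (Hi : sval J' i),
    @up_pr J' (exist _ i Hi) \c ds_map up_sys r = @up_pr J (exist _ i (r i Hi));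
  up_ob : C;
  up_inj : forall J, hom (up_sys J) up_ob;
  up_lim : is_dirlim up_inj
}.

Arguments up_sys {C I U X} _.
Arguments up_pr {C I U X} _ _ _.
Arguments up_ob {C I U X} _.
Arguments up_inj {C I U X} _ _.

(* [h] is the map induced by [f] on ultrapowers: it is induced by the maps
   [f^J : X^J -> Y^J]. *)
Definition is_ultrapower_map (C : preaddcat) (I : small) (U : set_system I)
    (X Y : C) (f : hom X Y) (A : ultrapower U X) (B : ultrapower U Y)
    (h : hom (up_ob A) (up_ob B)) : Prop :=
  forall J, exists fJ : hom (up_sys A J) (up_sys B J),
    (forall i, up_pr B J i \c fJ = f \c up_pr A J i) /\
    h \c up_inj A J = up_inj B J \c fJ.

Definition pure_mono (C : preaddcat) (X Y : C) (f : hom X Y) : Prop :=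
  monic f /\
  exists (I : small) (U : set_system I), UltraFilter U /\
  exists (A : ultrapower U X) (B : ultrapower U Y)
         (h : hom (up_ob A) (up_ob B)),
    is_ultrapower_map f h /\ split_mono h.

Definition pure_injective (C : preaddcat) (N : C) : Prop :=
  forall (X Y : C) (f : hom X Y), pure_mono f ->
  forall g : hom X N, exists g' : hom Y N, g' \c f = g.

Arguments pure_injective : clear implicits.

Definition closed_products (C : preaddcat) (P : C -> Prop) : Prop :=
  forall (I : small) (X : I -> C) (M : C) (pr : forall i, hom M (X i)),
    is_product pr -> (forall i, P (X i)) -> P M.

Definition closed_dirlims (C : preaddcat) (P : C -> Prop) : Prop :=
  forall (K : small) (le : K -> K -> Prop), directed le ->
  forall (S : dirsys C le) (L : C) (inj : forall k, hom (S k) L),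
    is_dirlim inj -> (forall k, P (S k)) -> P L.

Definition closed_pure_subobjects (C : preaddcat) (P : C -> Prop) : Prop :=
  forall (M N : C) (f : hom M N), pure_mono f -> P N -> P M.

Definition definable_subcat (R : preaddcat) (P : Mod R -> Prop) : Prop :=
  [/\ closed_products P, closed_dirlims P & closed_pure_subobjects P].

Definition definable (D : preaddcat) : Prop :=
  exists (R : preaddcat), skeletally_small R /\
  exists P : Mod R -> Prop, definable_subcat P /\ equivalent D (full_sub P).

Definition DEF_morphism (D C : preaddcat) (F : functor D C) : Prop :=
  preserves_products F /\ preserves_dirlims F.

(* Main.v *)
(* Ultrapowers make sense in any category with products and direct limits, so
   [F] and [G] preserve them, and hence preserve pure monomorphisms.  Let
   [f : X -> N] be a pure monomorphism into a pure-injective object whose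
   ultrapower [h : X* -> N*] is split by [r], and let [k = dN - h r dN : N -> N*]
   with [dN] the diagonal.  Then [k f = 0], and [G f] is a kernel of [G k]: an
   element [y] of [G N] with [dN y = h (r (dN y))] lies in the image of [G f] at
   some (indeed almost every) coordinate.  Embedding [N*] in a pure-injective
   object as well, the component of [tau] at [X] is the unique factorization of
   [tau'_N (F f)] through [G f].

   It remains to embed [X] purely into a pure-injective object.  By definition of
   purity, [N] is pure-injective as soon as its diagonals into ultrapowers split,
   and we take [N = X^W] for a good ultrafilter [W] (constructed as by Kunen),
   which makes [X^W] algebraically compact. *)
From HB Require Import structures.
From mathcomp Require Import all_boot all_algebra boolp classical_sets filter.
From mathcomp Require wochoice.
From Stdlib Require List.
Require Import Defs.

Set Implicit Arguments.
Unset Strict Implicit.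
Unset Printing Implicit Defensive.
Import GRing.Theory.
Local Open Scope classical_set_scope.
Local Notation In := List.In.

(** * Good ultrafilters *)

(** Pure-injectivity of [X^W] has to be tested against extensions [B] of unbounded size, whereas an
    ultrafilter gives saturation only for a number of conditions fixed beforehand. The way out is
    additive: the conditions on one new value are cosets of subgroups coming from subsets of [X], so
    [X] alone bounds their number and [W] can be chosen from [X]. Goodness turns finite solvability
    into a solution: it attaches to every coordinate a finite list of conditions solvable there,
    such that each condition is listed at almost all coordinates. Purity by ultrapowers is awkward
    to establish directly. The bridge is [locally_pure], the existence of retractions on finite
    parts of the target: it holds for diagonals, passes to ultrapowers, and yields an actual
    retraction when the source is [X^W]. *)

Section WellOrder.
Variable T : Type.

(** The library principle yields unique least elements of inhabited boolean predicates; pairs give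
    totality and antisymmetry, triples give transitivity. *)
Lemma exists_well_order : exists lt : T -> T -> Prop,
  [/\ well_founded lt, forall x y z, lt x y -> lt y z -> lt x z &
      forall x y, [\/ lt x y, x = y | lt y x]].
Proof.
have [R woR] := wochoice.well_ordering_principle {classic T}.
have totR (x y : T) : R x y \/ R y x.
  have [|z [[]]] := woR (pred2 (x : {classic T}) y).
    by exists x; rewrite !inE eqxx.
  rewrite !inE => /orP[] /eqP -> m _.
    by left; apply: m; rewrite !inE eqxx orbT.
  by right; apply: m; rewrite !inE eqxx.
have antiR (x y : T) : R x y && R y x -> x = y.
  move=> /andP[xy yx]; have [|z [_ u]] := woR (pred2 (x : {classic T}) y).
    by exists x; rewrite !inE eqxx.
  have xx : R x x by case: (totR x x).
  have yy : R y y by case: (totR y y).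
  rewrite -(u x) ?(u y) //; split; rewrite ?inE ?eqxx ?orbT //;
    by move=> t; rewrite !inE => /orP[] /eqP ->.
have minR (P : T -> Prop) : (exists x, P x) ->
    exists2 z, P z & forall x, P x -> R z x.
  move=> [x Px]; have [|z [[zP zm] _]] := woR (fun x => `[< P x >]).
    by exists x; apply/asboolP.
  exists z; first by move/asboolP: zP.
  by move=> y Py; apply: zm; apply/asboolP.
have transR (x y z : T) : R x y -> R y z -> R x z.
  move=> xy yz.
  have [|m mP mm] := minR (fun t => [\/ t = x, t = y | t = z]).
    by exists x; constructor 1.
  have mx : R m x by apply: mm; constructor 1.
  have my : R m y by apply: mm; constructor 2.
  have mz : R m z by apply: mm; constructor 3.
  case: mP => e; subst m => //.
    by rewrite (antiR x y) ?xy.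
  by rewrite -(antiR y z) // yz.
exists (fun x y : T => R x y /\ x <> y); split.
- move=> x; apply: contrapT => nA.
  have [|z nz zm] := minR (fun x => ~ Acc (fun x y => R x y /\ x <> y) x).
    by exists x.
  apply: nz; constructor => y [yz ne]; apply: contrapT => ny.
  by apply: ne; apply: antiR; rewrite yz zm.
- move=> x y z [xy nxy] [yz nyz]; split; first exact: transR xy yz.
  by move=> e; subst z; apply: nxy; apply: antiR; rewrite xy yz.
- move=> x y; have [->|ne] := EM (x = y); first by constructor 2.
  have [h|h] := totR x y; first by constructor 1.
  by constructor 3; split => // /esym.
Qed.

(* Restricting to the least initial segment that surjects onto [T] makes every
   proper initial segment too small to do so. *)
Lemma exists_initial_well_order : exists (lt : T -> T -> Prop) (S : T -> Prop)
    (s : T -> T),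
  [/\ well_founded lt,
      forall x y z, lt x y -> lt y z -> lt x z,
      forall x y, [\/ lt x y, x = y | lt y x],
      forall x, exists2 y, S y & s y = x &
      forall x, S x -> forall t : T -> T, exists z, forall y, lt y x -> t y <> z].
Proof.
have [lt [wf tr tot]] := exists_well_order.
pose onto x := exists t : T -> T, forall z, exists2 y, lt y x & t y = z.
have small x : ~ onto x -> forall t : T -> T, exists z, forall y, lt y x -> t y <> z.
  move=> nx t; apply: contrapT => nz; apply: nx; exists t => z.
  apply: contrapT => ny; apply: nz; exists z => y yx e; apply: ny.
  by exists y.
have [[x0 ox0]|no] := EM (exists x, onto x); last first.
  exists lt, (fun=> True), id; split => // [x|x _].
    by exists x.
  by apply: small => ox; apply: no; exists x.
have [x [ox xm]] : exists x, onto x /\ forall y, lt y x -> ~ onto y.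
  elim/(well_founded_ind wf): x0 ox0 => x IH ox.
  have [[y [yx oy]]|n] := EM (exists y, lt y x /\ onto y); first exact: IH oy.
  by exists x; split => // y yx oy; apply: n; exists y.
have [t tP] := ox.
exists lt, (fun y => lt y x), t; split => // y yx.
by apply: small; apply: xm.
Qed.

End WellOrder.

Section GoodUltrafilter.
Variable Phi : small.

(* A subset of [code] encodes, via [task] and [copies], both a family of subsets
   of [index] indexed by [seq Phi] and a sequence of subsets of [code], so that
   [code] has as many subsets as there are such pairs. *)
Inductive code : small :=
  | TaskCode of seq Phi & seq code & seq (seq bool * seq Phi)
  | CopyCode of nat & code.

Definition index : small := (seq code * seq (seq bool * seq Phi))%type.

Definition task (A : code -> Prop) (u : seq Phi) : set index :=
  fun i => A (TaskCode u i.1 i.2).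

Definition copies (A : code -> Prop) (n : nat) : code -> Prop :=
  fun c => A (CopyCode n c).

(** The two decoded components are independent, so each task has a code for every sequence [x]; this
    freedom lets a code avoid everything burnt earlier. *)
Lemma task_copies (f : seq Phi -> set index) (x : nat -> code -> Prop) :
  exists A, task A = f /\ copies A = x.
Proof.
exists (fun c => match c with
  | TaskCode u s h => f u (s, h) | CopyCode n c => x n c end).
by split => //; apply: functional_extensionality_dep => u; apply/funext => -[].
Qed.

Fixpoint lookup (h : seq (seq bool * seq Phi)) (k : seq bool) : seq Phi :=
  if h is (k', v) :: h' then if k == k' then v else lookup h' k else [::].

(* Hausdorff's independent family of functions on [index]. *)
Definition indep (A : code -> Prop) (i : index) : seq Phi :=
  lookup i.2 [seq `[< A c >] | c <- i.1].

(** Finitely many subsets of [code] are told apart by their traces on a finite list of separating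
    codes; the index consists of that list and a table giving each trace its prescribed value. *)
Lemma indepP (As : seq (code -> Prop)) (v : (code -> Prop) -> seq Phi) :
  exists i, forall A, In A As -> indep A i = v A.
Proof.
have /choice[d dP] : forall p : (code -> Prop) * (code -> Prop), exists c,
    p.1 <> p.2 -> `[< p.1 c >] <> `[< p.2 c >].
  move=> [A B] /=; apply: contrapT => nd.
  apply: (nd); exists (TaskCode [::] [::] [::]) => ne; exfalso.
  apply: ne; apply/funext => c; apply/propext.
  have e : `[< A c >] = `[< B c >].
    by apply: contrapT => ne; apply: nd; exists c.
  by split => /asboolP h; apply/asboolP; [rewrite -e|rewrite e].
pose s := List.flat_map (fun A => List.map (fun B => d (A, B)) As) As.
have sP A B : In A As -> In B As ->
    [seq `[< A c >] | c <- s] = [seq `[< B c >] | c <- s] -> A = B.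
  move=> AAs BAs e; apply: contrapT => ne; apply: (dP (A, B) ne) => /=.
  have ds : In (d (A, B)) s.
    apply/List.in_flat_map; exists A; split => //.
    by apply/List.in_map_iff; exists B.
  by elim: s ds e => //= c s IH [-> [] //|cs [_ /IH]]; exact.
exists (s, [seq ([seq `[< A c >] | c <- s], v A) | A <- As]) => A.
rewrite /indep /= => AAs.
move: (s) (fun B => @sP A B AAs) => k e; clear s sP.
elim: As AAs e => //= B As IH AAs e.
case: eqP => [h|ne]; first by rewrite (e B) //; left.
case: AAs => [AB|AAs]; first by rewrite AB in ne.
by apply: IH => // C CAs; apply: e; right.
Qed.

(* [b] is the set of burnt functions, no longer independent of [F]. *)
Definition consistent (F : set_system index) (K : set index)
    (b : (code -> Prop) -> Prop) : Prop :=
  forall H, F H -> forall As (v : (code -> Prop) -> seq Phi),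
    (forall A, In A As -> ~ b A) ->
    exists i, [/\ H i, K i & forall A, In A As -> indep A i = v A].

Lemma consistentW F (K K' : set index) (b b' : (code -> Prop) -> Prop) :
  K `<=` K' -> (forall A, b A -> b' A) -> consistent F K b -> consistent F K' b'.
Proof.
move=> KK' bb' c H FH As v nb.
have [|i [Hi Ki iv]] := c H FH As v; first by move=> A /nb nb' /bb'.
by exists i; split => //; apply: KK'.
Qed.

Definition burn (b : (code -> Prop) -> Prop) (l : seq (code -> Prop)) A : Prop :=
  b A \/ In A l.

Lemma burn_cat b l l' A : burn (burn b l) l' A -> burn b (l ++ l') A.
Proof. by case=> [[|]|] h; [left|right|right] => //; apply/List.in_app_iff; [left|right]. Qed.

(** If [J] cannot be adjoined, some [H0] in [F] together with values [v0] on a finite list [As0]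
    excludes it. Burning [As0] reserves these functions for the values [v0], and every index so
    obtained lies outside [J]. *)
Lemma consistent_split F (FF : Filter F) K b J : consistent F K b ->
  consistent F (K `&` J) b \/ exists l, consistent F (K `\` J) (burn b l).
Proof.
move=> c; have [|n] := EM (consistent F (K `&` J) b); first by left.
right; move/existsNP: n => [H0] /not_implyP[FH0] /existsNP[As0] /existsNP[v0].
move=> /not_implyP[nb0 n]; exists As0 => H FH As v nb.
pose v' A := if `[< In A As0 >] then v0 A else v A.
have [| |i [[Hi H0i] Ki iv]] := c (H `&` H0) _ (As ++ As0) v'.
- exact: filterI.
- by move=> A /List.in_app_iff[/nb h|/nb0//] bA; apply: h; left.
exists i; split => //.
  split => // Ji; apply: n; exists i; split => // A AAs.
  rewrite iv; last by apply/List.in_app_iff; right.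
  by rewrite /v' asboolT.
move=> A AAs; rewrite iv; last by apply/List.in_app_iff; left.
by rewrite /v' asboolF // => A0; apply: (nb A AAs); right.
Qed.

(* The sets that no extension of [F] burning finitely many functions excludes. *)
Definition forced (F : set_system index) (b : (code -> Prop) -> Prop) : set_system index :=
  fun J => forall l, ~ consistent F (~` J) (burn b l).

Lemma forced_filter F b (FF : Filter F) : Filter (forced F b).
Proof.
split.
- move=> l /(_ _ filterT [::] (fun=> [::])) [|i [_ /=]] //; exact.
- move=> J1 J2 f1 f2 l c.
  have [c1|[l' c2]] := consistent_split FF (~` J1) c.
    by apply: (f1 l); apply: consistentW c1 => // i [].
  apply: (f2 (l ++ l')); apply: consistentW c2; last exact: burn_cat.
  by move=> i [nJ J1i] J2i; apply: nJ; split => //; apply: contrapT.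
- move=> J J' JJ' f l c; apply: (f l); apply: consistentW c => // i; exact: contra_not (JJ' i).
Qed.

Lemma sub_forced F b : F `<=` forced F b.
Proof. by move=> J FJ l /(_ J FJ [::] (fun=> [::])) [//|i []]. Qed.

(** A forced set can be adjoined with no burning, since the definition of [forced] excludes the
    other branch of [consistent_split]. *)
Lemma consistent_forced F b (FF : Filter F) : consistent F setT b -> consistent (forced F b) setT b.
Proof.
move=> c J fJ As v nb; have [c1|[l c1]] := consistent_split FF J c.
  by have [i [_ [_ Ji] iv]] := c1 setT filterT As v nb; exists i.
by case: (fJ l); apply: consistentW c1 => // i [].
Qed.

(** The second alternative is goodness in the form used later: the sets of those [i] for which [h i]
    contains a finite list [u] form a multiplicative refinement of [f] when [f] is decreasing in
    [u]. Either alternative persists in larger filters. *)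
Definition settles (F : set_system index) (f : seq Phi -> set index) : Prop :=
  (exists u, F (~` f u)) \/
  exists h : index -> seq Phi, forall p, F [set i | In p (h i) /\ f (h i) i].

(** If some [task A u] is not forced, its complement is adjoined at the price of a finite burning.
    Otherwise [indep A] itself becomes [h] and only [A] is burnt: giving it the value [s] on the
    forced set [task A s] keeps the requirements on [h] consistent. *)
Lemma settles_step F b (FF : Filter F) A : consistent F setT b -> ~ b A ->
  exists (F' : set_system index) l,
    [/\ Filter F', F `<=` F', consistent F' setT (burn b l) & settles F' (task A)].
Proof.
move=> c nbA; have [[u]|al] := EM (exists u, ~ forced F b (task A u)).
  move=> /existsNP[l /contrapT cl].
  exists (fun J => exists2 H, F H & H `&` ~` task A u `<=` J), l; split.
  - split.
    + by exists setT => //; exact: filterT.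
    + move=> J1 J2 [H1 FH1 s1] [H2 FH2 s2]; exists (H1 `&` H2); first exact: filterI.
      by move=> i [[h1 h2] k]; split; [apply: s1|apply: s2].
    + by move=> J J' JJ' [H FH s]; exists H => // i /s /JJ'.
  - by move=> H FH; exists H => // i [].
  - move=> J [H FH s] As v nb; have [i [Hi Ki iv]] := cl H FH As v nb.
    by exists i; split => //; apply: s.
  - by left; exists u, setT; [exact: filterT|move=> i []].
have {}al u : forced F b (task A u) by apply: contrapT => n; apply: al; exists u.
have fF := forced_filter b FF; have cF := consistent_forced FF c.
pose g (s : seq Phi) : set index :=
  fun i => (forall p, In p s -> In p (indep A i)) /\ task A (indep A i) i.
exists (fun J => exists K s, forced F b K /\ K `&` g s `<=` J), [:: A]; split.
- split.
  + by exists setT, [::]; split => //; exact: (@filterT _ _ fF).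
  + move=> J1 J2 [K1 [s1 [f1 h1]]] [K2 [s2 [f2 h2]]].
    exists (K1 `&` K2), (s1 ++ s2); split; first exact: (@filterI _ _ fF).
    move=> i [[k1 k2] [ps ts]]; split.
      by apply: h1; split=> //; split=> // p p1; apply: ps; apply/List.in_app_iff; left.
    by apply: h2; split=> //; split=> // p p2; apply: ps; apply/List.in_app_iff; right.
  + by move=> J J' JJ' [K [s [fK s']]]; exists K, s; split => // i /s' /JJ'.
- by move=> H /sub_forced fH; exists H, [::]; split => // i [].
- move=> J [K [s [fK h]]] As v nb.
  pose v' B := if `[< B = A >] then s else v B.
  have [| |i [[Ki ti] _ iv]] := cF (K `&` task A s) _ (A :: As) v'.
  + exact: (@filterI _ _ fF).
  + by move=> B /= [<- //|/nb n bB]; apply: n; left.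
  have iA : indep A i = s by rewrite iv /v' ?asboolT //; left.
  exists i; split => //.
    by apply: h; split => //; split; rewrite iA.
  move=> B BAs; rewrite iv; last by right.
  by rewrite /v' asboolF // => e; apply: (nb B BAs); right; left.
- right; exists (indep A) => p; exists setT, [:: p]; split; first exact: (@filterT _ _ fF).
  by move=> i [_ [ps ts]]; split => //; apply: ps; left.
Qed.

(* The transfinite induction: at each stage one task is settled, through a
   function [indep A] which is not among the finitely many burnt at each of the
   earlier stages. *)
Lemma settling_filter : exists2 F : set_system index, ProperFilter F &
  forall f, settles F f.
Proof.
have [lt [S [s [wf tr tot sS sm]]]] := exists_initial_well_order (code -> Prop).
pose before (x : code -> Prop)
    (st : forall y, lt y x -> set_system index * seq (code -> Prop)) : set_system index :=
  (* The full set is put in by hand, since the least stage has no predecessor. *)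
  fun J => J = setT \/ exists y (h : lt y x), (st y h).1 J.
pose burnt (x : code -> Prop)
    (st : forall y, lt y x -> set_system index * seq (code -> Prop)) : (code -> Prop) -> Prop :=
  fun A => exists y (h : lt y x), In A (st y h).2.
pose step x F b (p : set_system index * seq (code -> Prop)) :=
  [/\ Filter p.1, F `<=` p.1, consistent p.1 setT (burn b p.2) &
      S x -> settles p.1 (task (s x))].
have /choice[next nextP] :
    forall q : (code -> Prop) * set_system index * ((code -> Prop) -> Prop),
    exists p, (exists p, step q.1.1 q.1.2 q.2 p) -> step q.1.1 q.1.2 q.2 p.
  move=> q; have [[p h]|n] := EM (exists p, step q.1.1 q.1.2 q.2 p); first by exists p.
  (* A dummy value making [next] total; [stP] proves that every stage has a genuine step. *)
  by exists (set0, [::]).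
pose st := Fix wf (fun=> (set_system index * seq (code -> Prop))%type)
  (fun x st => next (x, before x st, burnt x st)).
have stE x : st x = next (x, before x (fun y _ => st y), burnt x (fun y _ => st y)).
  apply: Fix_eq => y f g fg; suff -> : f = g by [].
  by apply: functional_extensionality_dep => z; apply: functional_extensionality_dep.
have {nextP}stP x : step x (before x (fun y _ => st y)) (burnt x (fun y _ => st y)) (st x).
  elim/(well_founded_ind wf): x => x IH.
  rewrite stE; apply: (nextP (x, _, _)) => /=.
  have inc y z : lt y z -> lt z x -> (st y).1 `<=` (st z).1.
    by move=> yz /IH[_ sub _ _] J yJ; apply: sub; right; exists y, yz.
  have FF : Filter (before x (fun y _ => st y)).
    split; first by left.
    - move=> J1 J2 [->|[y [yx J1y]]]; first by rewrite setTI.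
      move=> [->|[z [zx J2z]]]; first by rewrite setIT; right; exists y, yx.
      have [Fy _ _ _] := IH y yx; have [Fz _ _ _] := IH z zx.
      right; case: (tot y z) => h.
      + by exists z, zx; apply: filterI => //; apply: inc J1y.
      + by exists z, zx; apply: filterI => //; rewrite -h.
      + by exists y, yx; apply: filterI => //; apply: inc J2z.
    - move=> J J' JJ' [e|[y [yx Jy]]].
        by left; apply/seteqP; split => // i _; apply: JJ'; rewrite e.
      by right; exists y, yx; have [Fy _ _ _] := IH y yx; apply: filterS Jy.
  have cF : consistent (before x (fun y _ => st y)) setT (burnt x (fun y _ => st y)).
    move=> J [->|[y [yx Jy]]] As v nb.
      by have [i iv] := indepP As v; exists i.
    have [_ _ c _] := IH y yx; apply: (c J Jy) => A /nb n [[z [zy zA]]|yA]; apply: n.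
      by exists z, (tr _ _ _ zy yx).
    by exists y, yx.
  have [Sx|nSx] := EM (S x); last first.
    exists (before x (fun y _ => st y), [::]); split => //.
    by apply: consistentW cF => // A; left.
  have [A [tA nA]] : exists A, task A = task (s x) /\ ~ burnt x (fun y _ => st y) A.
    (* Diagonalization: the [n]-th burnt functions of the stages below [x], one per stage, cannot
       exhaust the subsets of [code] when decoded by [copies _ n], because [x] is in [S]. A code
       whose [n]-th copy is the missed [z n], for every [n], differs from all burnt functions. *)
    have /choice[z zP] : forall n, exists z : code -> Prop, forall y, lt y x ->
        copies (List.nth n (st y).2 (fun=> False)) n <> z.
      move=> n.
      exact: sm Sx (fun y => copies (List.nth n (st y).2 (fun=> False)) n).
    have [A [tA cA]] := task_copies (task (s x)) z.
    exists A; split => // -[y [yx Ay]].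
    have [n [_ nA]] := List.In_nth _ _ (fun=> False) Ay.
    by apply: (zP n y yx); rewrite nA cA.
  have [F' [l [FF' sub c se]]] := settles_step FF cF nA.
  by exists (F', l); split => //= _; rewrite -tA.
have inc y z : lt y z -> (st y).1 `<=` (st z).1.
  by move=> yz; have [_ sub _ _] := stP z => J yJ; apply: sub; right; exists y, yz.
exists (fun J => exists x, (st x).1 J).
  split.
    move=> [x x0]; have [_ _ c _] := stP x.
    by have [|i []] := c _ x0 [::] (fun=> [::]).
  split.
  - by exists (fun=> False); have [Fx _ _ _] := stP (fun=> False); apply: filterT.
  - move=> J1 J2 [y J1y] [z J2z].
    have [Fy _ _ _] := stP y; have [Fz _ _ _] := stP z.
    case: (tot y z) => h.
    + by exists z; apply: filterI => //; apply: inc J1y.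
    + by exists z; apply: filterI => //; rewrite -h.
    + by exists y; apply: filterI => //; apply: inc J2z.
  - by move=> J J' JJ' [x xJ]; exists x; have [Fx _ _ _] := stP x; apply: filterS xJ.
move=> f; have [A [<- _]] := task_copies f (fun _ _ => False).
have [x Sx <-] := sS A; have [_ _ _ /(_ Sx)] := stP x.
by move=> [[u fu]|[h hP]]; [left; exists u, x|right; exists h => p; exists x].
Qed.

Lemma good_ultrafilter : exists (I : small) (W : set_system I), UltraFilter W /\
  forall f : seq Phi -> set I, (forall u, W (f u)) ->
  exists h : I -> seq Phi, forall p, W [set i | In p (h i) /\ f (h i) i].
Proof.
have [F FF se] := settling_filter; have [W [UW FW]] := ultraFilterLemma FF.
exists index, W; split => // f fW.
case: (se f) => [[u /FW nu]|[h hF]]; last by exists h => p; apply: FW.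
exfalso; apply: (@filter_not_empty _ W).
by rewrite -(setICr (f u)); apply: filterI.
Qed.

End GoodUltrafilter.

(** * Algebraic compactness of good ultrapowers *)

Definition el (A : preaddcat) (M : functor A Ab) (x : A) : zmodType := M x.

Definition act (A : preaddcat) (M : functor A Ab) (x y : A) (f : hom x y) :
  {additive el M x -> el M y} := fmap M f.

Definition app (A : preaddcat) (M N : functor A Ab) (t : nattrans M N) (x : A) :
  {additive el M x -> el N x} := t x.

Lemma act1 (A : preaddcat) (M : functor A Ab) x (a : el M x) : act M (idm x) a = a.
Proof. exact: (congr1 (fun g : {additive _ -> _} => g a) (fmap1 M x)). Qed.

Lemma act_cmp (A : preaddcat) (M : functor A Ab) x y z (g : @hom A y z) (f : hom x y) (a : el M x) :
  act M (g \c f) a = act M g (act M f a).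
Proof. exact: (congr1 (fun g : {additive _ -> _} => g a) (fmapM M g f)). Qed.

Section ModuleElements.
Variables (A : preaddcat) (M N : functor A Ab).
Local Open Scope ring_scope.

Lemma app_act (t : nattrans M N) x y (f : hom x y) (a : el M x) :
  app t y (act M f a) = act N f (app t x a).
Proof. exact: (congr1 (fun g : {additive _ -> _} => g a) (ntN t f)). Qed.

Lemma app_inj (s t : nattrans M N) : (forall x, app s x =1 app t x) -> s = t.
Proof. by move=> st; apply: nattrans_eq => x; apply: additive_eq; apply: st. Qed.

Lemma nattrans_of (v : forall x, el M x -> el N x) :
  (forall x a b, v x (a + b) = v x a + v x b) ->
  (forall x y (f : hom x y) a, v y (act M f a) = act N f (v x a)) ->
  exists t : nattrans M N, forall x a, app t x a = v x a.
Proof.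
move=> vD vA.
have vB x : zmod_morphism (v x).
  move=> a b; apply: (addIr (v x b)); by rewrite -vD !subrK.
pose h x : {additive el M x -> el N x} :=
  HB.pack (v x) (GRing.isZmodMorphism.Build _ _ _ (vB x)).
unshelve eexists (@NatTrans A Ab M N h _) => // x y f.
by apply: additive_eq => a; exact: vA.
Qed.

Section Skeleton.
Variables (S : small) (s : S -> A).
Hypothesis s_onto : forall x, exists i, isomorphic (s i) x.

Lemma app_inj_skeleton (t t' : nattrans M N) :
  (forall i, app t (s i) =1 app t' (s i)) -> t = t'.
Proof.
move=> tt'; apply: app_inj => x a.
have [i [f [g [gf fg]]]] := s_onto x.
by rewrite -[a]act1 -fg act_cmp !(app_act _ f) tt'.
Qed.

(** Values are transported along chosen isomorphisms with the objects [s i]. Indexing by the small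
    [S] keeps the elements of a module in a set, as the later choice of [Phi] requires. *)
Lemma nattrans_of_skeleton (v : forall i, el M (s i) -> el N (s i)) :
  (forall i a b, v i (a + b) = v i a + v i b) ->
  (forall i j (f : hom (s i) (s j)) a, v j (act M f a) = act N f (v i a)) ->
  exists t : nattrans M N, forall i a, app t (s i) a = v i a.
Proof.
move=> vD vA.
have ex x : exists p : {i : S & (hom (s i) x * hom x (s i))%type},
    (projT2 p).1 \c (projT2 p).2 = idm x.
  have [i [f [g [gf fg]]]] := s_onto x.
  by exists (existT _ i (f, g)).
pose k x := projT1 (sval (cid (ex x))).
pose f x : hom (s (k x)) x := (projT2 (sval (cid (ex x)))).1.
pose g x : hom x (s (k x)) := (projT2 (sval (cid (ex x)))).2.
have fg x : f x \c g x = idm x by exact: (svalP (cid (ex x))).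
have [| |t tP] := @nattrans_of (fun x a => act N (f x) (v _ (act M (g x) a))).
- by move=> x a b; rewrite !(raddfD, vD).
- move=> x y h a.
  have e : act M (g y) (act M h a) = act M (g y \c h \c f x) (act M (g x) a).
    by rewrite -!act_cmp -[in RHS]cmpA fg cmpm1.
  by rewrite e vA -!act_cmp !cmpA fg cmp1m.
exists t => i a; rewrite tP -vA -act_cmp fg.
by rewrite act1.
Qed.

End Skeleton.
End ModuleElements.

Lemma filter_list (I : Type) (W : set_system I) (FW : Filter W) (T : Type) (L : seq T)
    (P : T -> set I) :
  (forall c, In c L -> W (P c)) -> W [set i | forall c, In c L -> P c i].
Proof.
elim: L => [|c L IH] h.
  by apply: (@filterS _ _ FW setT) => [i _ c []|]; exact: filterT.
have h1 := h c (or_introl erefl); have h2 := IH (fun d dL => h d (or_intror dL)).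
by apply: filterS (filterI h1 h2) => i [Pi Li] d /= [<- //|/Li].
Qed.

Section Conditions.
Variables (A : preaddcat) (B E : functor A Ab) (S : small) (s : S -> A).
Hypothesis s_onto : forall x, exists i, isomorphic (s i) x.
Local Open Scope ring_scope.
Local Notation elS M i := (el M (s i)).

Definition pair_at : Type := {x : S & elS B x * elS E x}%type.

(* Conditions on a family of functions [v x : B x -> E x]: additivity at a pair,
   equivariance at an element, and a prescribed value.  Finite lists of them
   play the role of positive primitive formulas. *)
Inductive cond : Type :=
  | CAdd (x : S) (a b : elS B x)
  | CAct (x y : S) (f : hom (s x) (s y)) (a : elS B x)
  | CVal (p : pair_at).

Definition holds (v : forall x, elS B x -> elS E x) (c : cond) : Prop :=
  match c with
  | CAdd x a b => v x (a + b) = v x a + v x b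
  | CAct x y f a => v y (act B f a) = act E f (v x a)
  | CVal p => v (projT1 p) (projT2 p).1 = (projT2 p).2
  end.

(** The homogeneous version, satisfied by differences of solutions. The prescribed element of [E] is
    replaced by 0, so it can be read in [X] as well as in [E]. *)
Definition holds0 (M : functor A Ab) (v : forall x, elS B x -> elS M x) (c : cond) : Prop :=
  match c with
  | CAdd x a b => v x (a + b) = v x a + v x b
  | CAct x y f a => v y (act B f a) = act M f (v x a)
  | CVal p => v (projT1 p) (projT2 p).1 = 0
  end.

Definition allowed (G : set pair_at) (c : cond) : Prop :=
  if c is CVal p then G p else True.

Definition finitely_extendable (G : set pair_at) : Prop :=
  forall L, (forall c, In c L -> allowed G c) -> exists v, forall c, In c L -> holds v c.

Lemma holdsB v v' c : holds v c -> holds v' c -> holds0 (fun x b => v x b - v' x b) c.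
Proof.
case: c => [x a b|x y f a|p] /= -> ->; first by rewrite opprD addrACA.
  by rewrite raddfB.
by rewrite subrr.
Qed.

Lemma holdsD v v' c : holds v c -> holds0 v' c -> holds (fun x b => v x b + v' x b) c.
Proof.
case: c => [x a b|x y f a|p] /= -> ->; first by rewrite addrACA.
  by rewrite raddfD.
by rewrite addr0.
Qed.

(** Lists of two, three and four conditions suffice: they show that prescribed values are unique,
    equivariant and additive. *)
Lemma finitely_extendable_total (G : set pair_at) :
  finitely_extendable G -> (forall x b, exists e, G (existT _ x (b, e))) ->
  exists t : nattrans B E, forall p, G p -> app t (s (projT1 p)) (projT2 p).1 = (projT2 p).2.
Proof.
move=> ext tot.
pose v x b := sval (cid (tot x b)).
have vG x b : G (existT _ x (b, v x b)) by rewrite /v; case: cid.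
have [| |t tv] := @nattrans_of_skeleton A B E S s s_onto v.
- move=> x a b.
  have [|w wP] := ext [:: CAdd a b; CVal (existT _ x (a, v x a));
    CVal (existT _ x (b, v x b)); CVal (existT _ x (a + b, v x (a + b)))].
    by move=> c /= [<- //|[<-|[<-|[<-|//]]]]; exact: vG.
  have /= h1 := wP _ (or_introl erefl).
  have /= h2 := wP _ (or_intror (or_introl erefl)).
  have /= h3 := wP _ (or_intror (or_intror (or_introl erefl))).
  have /= h4 := wP _ (or_intror (or_intror (or_intror (or_introl erefl)))).
  by rewrite -h2 -h3 -h4.
- move=> x y f a.
  have [|w wP] := ext [:: CAct f a; CVal (existT _ x (a, v x a));
    CVal (existT _ y (act B f a, v y (act B f a)))].
    by move=> c /= [<- //|[<-|[<-|//]]]; exact: vG.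
  have /= h1 := wP _ (or_introl erefl).
  have /= h2 := wP _ (or_intror (or_introl erefl)).
  have /= h3 := wP _ (or_intror (or_intror (or_introl erefl))).
  by rewrite -h2 -h3.
exists t => -[x [b e]] Gp /=; rewrite tv.
have [|w wP] := ext [:: CVal (existT _ x (b, e)); CVal (existT _ x (b, v x b))].
  by move=> c /= [<- //|[<-|//]]; exact: vG.
have /= h1 := wP _ (or_introl erefl).
have /= h2 := wP _ (or_intror (or_introl erefl)).
by rewrite -h1 -h2.
Qed.

(* A condition involves at most one member of [G], so finite extendability
   passes to unions of chains. *)
Lemma finitely_extendable_maximal (G0 : set pair_at) : finitely_extendable G0 ->
  (forall G, G0 `<=` G -> finitely_extendable G -> forall x b,
    exists e, finitely_extendable (G `|` [set existT _ x (b, e)])) ->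
  exists t : nattrans B E, forall p, G0 p -> app t (s (projT1 p)) (projT2 p).1 = (projT2 p).2.
Proof.
move=> ext0 step.
(* Zorn is applied to the part added to [G0]; the empty chain is then covered by the hypothesis on
   [G0]. *)
have [F Fch|G [extG maxG]] :=
    @Zorn_bigcup pair_at (fun G => finitely_extendable (G0 `|` G)).
  move=> ch L al.
  have [[F1 FF1]|nF] := EM (exists F1, F F1); last first.
    apply: ext0 => c /al; case: c => // p [//|[F1 FF1 _]].
    by case: nF; exists F1.
  suff [F2 FF2 alF2] : exists2 F2, F F2 & forall c, In c L -> allowed (G0 `|` F2) c.
    exact: (Fch F2).
  elim: L al => [|c L IH] al; first by exists F1.
  have [|F2 FF2 F2P] := IH; first by move=> d dL; apply: al; right.
  have : allowed (G0 `|` \bigcup_(X in F) X) c by apply: al; left.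
  case: c {al} => [x a b|x y f a|p] /=.
  - by move=> _; exists F2 => // c [<- //|]; apply: F2P.
  - by move=> _; exists F2 => // c [<- //|]; apply: F2P.
  - case=> [G0p|[F3 FF3 F3p]].
      by exists F2 => // c [<-|]; [left|apply: F2P].
    have [sub|sub] := ch _ _ FF2 FF3.
      exists F3 => // c [<-|/F2P]; first by right.
      by case: c => //= q [|/sub]; [left|right].
    exists F2 => // c [<-|]; last exact: F2P.
    by right; apply: sub.
have [|t tP] := @finitely_extendable_total (G0 `|` G) extG; last first.
  by exists t => p G0p; apply: tP; left.
move=> x b; have [e] := step _ (@subsetUl _ G0 G) extG x b.
rewrite -setUA => exte; exists e; right; apply: contrapT => nG.
apply: (maxG _ _ exte); split; first exact: subsetUl.
by move=> sub; apply: nG; apply: sub; right.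
Qed.

End Conditions.

Section Ultrapower.
Variables (A : preaddcat) (X E : functor A Ab) (S : small) (s : S -> A).
Variables (I : small) (W : set_system I).
Variable FW : Filter W.
Hypothesis s_onto : forall x, exists i, isomorphic (s i) x.
Variable cls : forall x, (I -> el X x) -> el E x.
Local Open Scope ring_scope.

(** An axiomatic reduced power of [X] modulo [W], which keeps the arguments below independent of the
    direct limit by which ultrapowers are defined. *)
Record is_class_map : Prop := IsClassMap {
  cls_surj : forall x (e : el E x), exists u, cls u = e;
  clsD : forall x (u v : I -> el X x), cls (fun i => u i + v i) = cls u + cls v;
  cls0 : forall x (u : I -> el X x), cls u = 0 <-> W [set i | u i = 0];
  cls_act : forall x y (f : hom x y) (u : I -> el X x),
    act E f (cls u) = cls (fun i => act X f (u i))
}.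

Local Notation elS M i := (el M (s i)).

Hypothesis cm : is_class_map.

Lemma clsB x (u v : I -> el X x) : cls (fun i => u i - v i) = cls u - cls v.
Proof.
apply: (addIr (cls v)); rewrite -(clsD cm) subrK; congr cls.
by apply/funext => i; rewrite subrK.
Qed.

Lemma cls_eq x (u v : I -> el X x) : cls u = cls v <-> W [set i | u i = v i].
Proof.
have -> : [set i | u i = v i] = [set i | u i - v i = 0].
  by apply/funext => i; apply/propext; split=> /= [->|/subr0_eq //]; rewrite subrr.
rewrite -(cls0 cm) clsB; split=> [->|/subr0_eq //].
by rewrite subrr.
Qed.

Definition star x (Y : el X x -> Prop) (e : el E x) : Prop :=
  exists2 u, cls u = e & W [set i | Y (u i)].

Section Coset.
Variables (B : functor A Ab) (x0 : S) (c0 : elS B x0).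

(** A pp-definable subgroup: the values of [v] occurring in the finite list [L] are the
    existentially quantified variables, [v x0 c0] the free one. *)
Definition values (L : seq (cond B E s)) (y : elS X x0) : Prop :=
  exists2 v : forall x, elS B x -> elS X x, (forall c, In c L -> holds0 v c) & v x0 c0 = y.

(** One half of Łoś's theorem for these formulas: the difference of two solutions is lifted to
    coordinates, where finitely many conditions hold together almost everywhere. *)
Lemma holds_values L (v v' : forall x, elS B x -> elS E x) :
  (forall c, In c L -> holds v c) -> (forall c, In c L -> holds v' c) ->
  star (values L) (v x0 c0 - v' x0 c0).
Proof.
move=> vL v'L.
pose w x b := sval (cid (cls_surj cm (v x b - v' x b))).
have wE x b : cls (w x b) = v x b - v' x b by rewrite /w; case: cid.
exists (w x0 c0); first exact: wE.
suff : W [set i | forall c, In c L -> holds0 (fun x b => w x b i) c].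
  by apply: filterS => i wi; exists (fun x b => w x b i).
apply: filter_list => c cL; have := holdsB (vL c cL) (v'L c cL).
case: c {cL} => [x a b|x y f a|p] /=.
- by rewrite -!wE -(clsD cm) => /cls_eq.
- by rewrite -!wE (cls_act cm) => /cls_eq.
- by rewrite -wE => /(cls0 cm).
Qed.

(** The converse half: coordinatewise homogeneous solutions are glued by [cls] and added to the
    given solution [v]. *)
Lemma values_holds L (v : forall x, elS B x -> elS E x) e :
  (forall c, In c L -> holds v c) -> star (values L) (e - v x0 c0) ->
  exists2 v', forall c, In c L -> holds v' c & v' x0 c0 = e.
Proof.
move=> vL [u ue Wu].
have /choice[w wP] : forall i, exists w : forall x, elS B x -> elS X x,
    values L (u i) -> (forall c, In c L -> holds0 w c) /\ w x0 c0 = u i.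
  move=> i; have [[w wL we]|n] := EM (values L (u i)); first by exists w.
  by exists (fun _ _ => 0).
exists (fun x b => v x b + cls (fun i => w i x b)).
  move=> c cL; apply: (holdsD (vL c cL)).
  have : W [set i | holds0 (w i) c] by apply: filterS Wu => i /wP[h _]; apply: h.
  case: c {cL} => [x a b|x y f a|p] /=.
  - by move=> h; rewrite -(clsD cm); apply/cls_eq.
  - by move=> h; rewrite (cls_act cm); apply/cls_eq.
  - by move=> h; apply/(cls0 cm).
have -> : cls (fun i => w i x0 c0) = cls u.
  by apply/cls_eq; apply: filterS Wu => i /wP[].
by rewrite ue addrC subrK.
Qed.

End Coset.

Variable Phi : small.
Hypothesis goodW : forall f : seq Phi -> set I, (forall u, W (f u)) ->
  exists h : I -> seq Phi, forall p, W [set i | In p (h i) /\ f (h i) i].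
Hypothesis Phi_onto : forall x : S, exists d : Phi -> (elS X x -> Prop),
  forall Y, exists p, d p = Y.

(** Saturation. Goodness is applied to the sets of coordinates at which finitely many of the
    constraints have a common solution; a solution [z i] of the constraints listed in [h i] then
    meets each single constraint almost everywhere. *)
Lemma star_compact x (Sel : (elS X x -> Prop) -> Prop) (a : (elS X x -> Prop) -> elS E x) :
  (forall l, (forall Y, In Y l -> Sel Y) -> exists e, forall Y, In Y l -> star Y (e - a Y)) ->
  exists e, forall Y, Sel Y -> star Y (e - a Y).
Proof.
move=> fip; have [d dP] := Phi_onto x.
pose al Y := sval (cid (cls_surj cm (a Y))).
have alE Y : cls (al Y) = a Y by rewrite /al; case: cid.
pose sol (l : seq Phi) i (z : elS X x) :=
  forall p, In p l -> Sel (d p) -> d p (z - al (d p) i).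
have [l|h hP] := goodW (f := fun l i => exists z, sol l i z).
  have [|e eP] := fip (List.filter (fun Y => `[< Sel Y >]) (List.map d l)).
    by move=> Y /List.filter_In[_ /asboolP].
  have [xi xiE] := cls_surj cm e.
  suff : W [set i | sol l i (xi i)] by apply: filterS => i h; exists (xi i).
  apply: filter_list => p ps; have [Sp|nS] := EM (Sel (d p)); last first.
    by apply: filterS filterT.
  have [|u uE Wu] := eP (d p).
    by apply/List.filter_In; split; [apply/List.in_map|apply/asboolP].
  have Wx : W [set i | u i = xi i - al (d p) i].
    by apply/cls_eq; rewrite clsB uE xiE alE.
  by apply: filterS (filterI Wu Wx) => i [/= Yu <-].
have /choice[z zP] : forall i, exists z, (exists z, sol (h i) i z) -> sol (h i) i z.
  by move=> i; have [[z zi]|n] := EM (exists z, sol (h i) i z); [exists z|exists 0].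
exists (cls z) => Y SY; have [p pY] := dP Y.
exists (fun i => z i - al Y i); first by rewrite clsB alE.
by apply: filterS (hP p) => i [pi /zP/(_ p pi)]; rewrite pY; apply.
Qed.

(* [X^W] is algebraically compact.  The conditions on the value at [c0] of an
   extension form cosets of the subgroups [star (values L)], and two such
   cosets of the same subgroup coincide: there are no more of them than
   subgroups of [X x0]. *)
Lemma ultrapower_compact (B : functor A Ab) (G0 : set (pair_at B E s)) :
  finitely_extendable G0 ->
  exists t : nattrans B E, forall p, G0 p -> app t (s (projT1 p)) (projT2 p).1 = (projT2 p).2.
Proof.
move=> ext0; apply: finitely_extendable_maximal => // G _ ext x0 c0.
pose ok L := forall c : cond B E s, In c L -> allowed G c.
pose Sel Y := exists2 L, ok L & values c0 L = Y.
(* One list of conditions, and below one solution, is fixed for each subgroup; this replaces an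
   unbounded family of lists by one indexed by subsets of [X x0]. *)
have /choice[Ls LsP] : forall Y, exists L, Sel Y -> ok L /\ values c0 L = Y.
  by move=> Y; have [[L Lok LY]|n] := EM (Sel Y); [exists L|exists [::]].
have /choice[vs vsP] : forall Y, exists v, Sel Y -> forall c, In c (Ls Y) -> holds v c.
  move=> Y; have [/LsP[/ext[v vL] _]|n] := EM (Sel Y); first by exists v.
  by exists (fun _ _ => 0).
have [l lS|e0 e0P] := @star_compact x0 Sel (fun Y => vs Y x0 c0).
  have [c|v vP] := ext (List.flat_map Ls l).
    by move=> /List.in_flat_map[Y [Yl]]; have [h _] := LsP Y (lS Y Yl); apply: h.
  exists (v x0 c0) => Y Yl; have SY := lS Y Yl.
  have := @holds_values B x0 c0 (Ls Y) v (vs Y) _ (vsP Y SY).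
  have [_ ->] := LsP Y SY; apply => c cL.
  by apply: vP; apply/List.in_flat_map; exists Y.
exists e0 => L Lok.
pose L1 := List.filter (fun c => `[< allowed G c >]) L.
have L1ok : ok L1 by move=> c /List.filter_In[_ /asboolP].
pose Y := values c0 L1; have SY : Sel Y by exists L1.
have [Lsok LsY] := LsP Y SY.
(* The common solution [v1] compares [L1] with the list chosen for the same subgroup [Y]: as a
   solution of [Ls Y] it places [e0 - v1 x0 c0] in [star Y], and as a solution of [L1] it can then
   be corrected to take the value [e0]. *)
have [c|v1 v1P] := ext (L1 ++ Ls Y).
  by move=> /List.in_app_iff[]; [apply: L1ok|apply: Lsok].
have st0 := e0P Y SY; rewrite -{1}LsY in st0.
have [v2 v2P v2e] := values_holds (vsP Y SY) st0.
have st1 : star Y (e0 - v1 x0 c0).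
  rewrite -LsY -v2e; apply: holds_values => // c cL.
  by apply: v1P; apply/List.in_app_iff; right.
have [|v vP ve] := @values_holds B x0 c0 L1 v1 e0 _ st1.
  by move=> c cL; apply: v1P; apply/List.in_app_iff; left.
exists v => c cL; have [Gc|nG] := EM (allowed G c).
  by apply: vP; apply/List.filter_In; split=> //; apply/asboolP.
have := Lok c cL; case: c {cL} nG => [x a b|x y f a|p] //= nG.
by case=> [//|->].
Qed.

End Ultrapower.

Section LocalPurity.
Variables (A : preaddcat) (S : small) (s : S -> A).
Local Open Scope ring_scope.
Local Notation elS M i := (el M (s i)).

(** The partial map from [N] back to [M] that a retraction of [f] has to extend. *)
Definition graph (M N : functor A Ab) (f : nattrans M N) : set (pair_at N M s) :=
  fun p => app f (s (projT1 p)) (projT2 p).2 = (projT2 p).1.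

Definition locally_pure (M N : functor A Ab) (f : nattrans M N) : Prop :=
  finitely_extendable (graph f).

Variables (I : small) (W : set_system I).
Hypothesis FW : ProperFilter W.

Section Transfer.
Variables (M M' : functor A Ab) (clsM : forall x, (I -> el M x) -> el M' x).
Hypothesis cM : is_class_map W clsM.

(** Representatives of the elements of [M'] satisfy a finite list of conditions at almost every
    coordinate; reading them off at one such coordinate gives the solution. *)
Lemma locally_pure_diagonal (f : nattrans M M') :
  (forall x a, app f x a = clsM (fun=> a)) -> locally_pure f.
Proof.
move=> fE L Lok.
pose w x b := sval (cid (cls_surj cM b)) : I -> elS M x.
have wE x b : clsM (w x b) = b by rewrite /w; case: cid.
have : W [set i | forall c, In c L -> holds (fun x b => w x b i) c].
  apply: filter_list => c /Lok; case: c => [x a b|x y g a|[x [b e]]] /=.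
  - by move=> _; apply/(cls_eq cM); rewrite (clsD cM) !wE.
  - by move=> _; apply/(cls_eq cM); rewrite -(cls_act cM) !wE.
  - by rewrite /graph /= fE => h; apply/(cls_eq cM); rewrite wE.
by move=> /filter_ex[i iL]; exists (fun x b => w x b i).
Qed.

Variables (N N' : functor A Ab) (clsN : forall x, (I -> el N x) -> el N' x).
Hypothesis cN : is_class_map W clsN.

(** The conditions are solved at each coordinate and the solutions glued by [clsM]. The chosen
    representative of a sum or image is the sum or image only almost everywhere, which suffices
    after passing to classes. *)
Lemma locally_pure_ultrapower (f : nattrans M N) (f' : nattrans M' N') :
  (forall x u, app f' x (clsM u) = clsN (fun i => app f x (u i))) ->
  locally_pure f -> locally_pure f'.
Proof.
move=> fE pf L Lok.
pose wM x b := sval (cid (cls_surj cM b)) : I -> elS M x.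
have wME x b : clsM (wM x b) = b by rewrite /wM; case: cid.
pose wN x b := sval (cid (cls_surj cN b)) : I -> elS N x.
have wNE x b : clsN (wN x b) = b by rewrite /wN; case: cid.
pose at_ i (c : cond N' M' s) : cond N M s := match c with
  | CAdd x a b => CAdd M (wN x a i) (wN x b i)
  | CAct x y g a => CAct M g (wN x a i)
  | CVal p => CVal (existT _ (projT1 p) (wN _ (projT2 p).1 i, wM _ (projT2 p).2 i))
  end.
have /choice[v vP] : forall i, exists v : forall x, elS N x -> elS M x,
    (forall c, In c L -> allowed (graph f) (at_ i c)) -> forall c, In c L -> holds v (at_ i c).
  move=> i; have [al|n] := EM (forall c, In c L -> allowed (graph f) (at_ i c)).
    have [|v vL] := pf (List.map (at_ i) L).
      by move=> c /List.in_map_iff[d [<- /al]].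
    by exists v => _ c cL; apply: vL; apply/List.in_map_iff; exists c.
  by exists (fun _ _ => 0).
exists (fun x b => clsM (fun i => v i x (wN x b i))) => c0 c0L.
have Wv : W [set i | forall c, In c L -> holds (v i) (at_ i c)].
  suff : W [set i | forall c, In c L -> allowed (graph f) (at_ i c)].
    by apply: filterS => i /vP.
  apply: filter_list => c /Lok; case: c => [x a b|x y g a|[x [b e]]] /=;
    try by move=> _; apply: filterT.
  by rewrite /graph /= => h; apply/(cls_eq cN); rewrite wNE -fE wME.
have {}Wv : W [set i | holds (v i) (at_ i c0)] by apply: filterS Wv => i; apply.
move: Wv (Lok _ c0L); case: c0 {c0L} => [x a b|x y g a|[x [b e]]] /=.
- move=> Wv _; rewrite -(clsD cM); apply/(cls_eq cM).
  have : W [set i | wN x (a + b) i = wN x a i + wN x b i].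
    by apply/(cls_eq cN); rewrite (clsD cN) !wNE.
  by move=> /(filterI Wv); apply: filterS => i [/= <- ->].
- move=> Wv _; rewrite (cls_act cM); apply/(cls_eq cM).
  have : W [set i | wN y (act N' g a) i = act N g (wN x a i)].
    by apply/(cls_eq cN); rewrite -(cls_act cN) !wNE.
  by move=> /(filterI Wv); apply: filterS => i [/= <- ->].
- by move=> Wv _; rewrite -[RHS]wME; apply/(cls_eq cM).
Qed.

End Transfer.

Lemma locally_pure_split (X E : functor A Ab) (cls : forall x, (I -> el X x) -> el E x)
    (Phi : small) (B : functor A Ab) (f : nattrans E B) :
  (forall x, exists i, isomorphic (s i) x) -> is_class_map W cls ->
  (forall f : seq Phi -> set I, (forall u, W (f u)) ->
    exists h : I -> seq Phi, forall p, W [set i | In p (h i) /\ f (h i) i]) ->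
  (forall x, exists d : Phi -> (elS X x -> Prop), forall Y, exists p, d p = Y) ->
  locally_pure f -> exists t : nattrans B E, nt_comp t f = nt_id E.
Proof.
move=> s_onto cm good onto /(ultrapower_compact _ s_onto cm good onto)[t tP].
exists t; apply: (app_inj_skeleton s_onto) => i e.
exact: (tP (existT _ i (app f (s i) e, e))).
Qed.

End LocalPurity.

(** * Products and direct limits of modules *)

Section ProductGroup.
Variables (I : small) (V : I -> zmodType).
Local Open Scope ring_scope.

Definition dprod : small := forall i, V i.

HB.instance Definition _ := gen_eqMixin dprod.
HB.instance Definition _ := gen_choiceMixin dprod.

Let add (u v : dprod) : dprod := fun i => u i + v i.

Lemma dprod_addA : associative add.
Proof. by move=> u v w; apply: functional_extensionality_dep => i; exact: addrA. Qed.
Lemma dprod_addC : commutative add.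
Proof. by move=> u v; apply: functional_extensionality_dep => i; exact: addrC. Qed.
Lemma dprod_add0 : left_id ((fun=> 0) : dprod) add.
Proof. by move=> u; apply: functional_extensionality_dep => i; exact: add0r. Qed.
Lemma dprod_addN : left_inverse ((fun=> 0) : dprod) (fun u i => - u i) add.
Proof. by move=> u; apply: functional_extensionality_dep => i; exact: addNr. Qed.

HB.instance Definition _ :=
  GRing.isZmodule.Build dprod dprod_addA dprod_addC dprod_add0 dprod_addN.

End ProductGroup.

Section Products.
Variables (A : preaddcat) (I : small) (X : I -> funcat A Ab).
Local Open Scope ring_scope.

Definition pointwise_product (P : funcat A Ab) (pr : forall i, hom P (X i)) : Prop :=
  forall x, (forall u : forall i, el (X i) x, exists p, forall i, app (pr i) x p = u i) /\
            (forall p : el P x, (forall i, app (pr i) x p = 0) -> p = 0).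

Lemma funcat_product : exists (P : funcat A Ab) (pr : forall i, hom P (X i)),
  is_product pr /\ pointwise_product pr.
Proof.
pose V x : zmodType := dprod (fun i => el (X i) x).
have mB x y (f : hom x y) : zmod_morphism (fun (u : V x) => (fun i => act (X i) f (u i)) : V y).
  by move=> u v; apply: functional_extensionality_dep => i; exact: raddfB.
pose m x y (f : hom x y) : {additive V x -> V y} :=
  HB.pack (fun (u : V x) => (fun i => act (X i) f (u i)) : V y)
    (GRing.isZmodMorphism.Build _ _ _ (mB x y f)).
have m1 x : m x x (idm x) = @idm Ab (V x).
  by apply: additive_eq => u; apply: functional_extensionality_dep => i; exact: act1.
have mM x y z (g : hom y z) (f : hom x y) : m x z (g \c f) = (m y z g : @hom Ab _ _) \c m x y f.
  apply: additive_eq => u.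
  by apply: functional_extensionality_dep => i; exact: act_cmp.
have mD x y (f g : hom x y) : m x y (hadd f g) = @hadd Ab _ _ (m x y f) (m x y g).
  apply: additive_eq => u; apply: functional_extensionality_dep => i.
  exact: (congr1 (fun g : {additive _ -> _} => g (u i)) (fmapD (X i) f g)).
pose P : funcat A Ab := @Functor A Ab V m m1 mM mD.
have ex i : exists t : nattrans P (X i), forall x (a : el P x), app t x a = (a : V x) i.
  by apply: nattrans_of.
pose pr i : hom P (X i) := sval (cid (ex i)).
have prE i x (a : el P x) : app (pr i) x a = (a : V x) i by exact: (svalP (cid (ex i))).
exists P, pr; split; last first.
  move=> x; split; first by move=> u; exists u => i; rewrite prE.
  by move=> p p0; apply: functional_extensionality_dep => i; rewrite -prE p0.
move=> Q q; have [| |h hE] := @nattrans_of A Q P (fun x a => (fun i => app (q i) x a) : V x).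
- by move=> x a b; apply: functional_extensionality_dep => i; exact: raddfD.
- by move=> x y f a; apply: functional_extensionality_dep => i; exact: app_act.
exists h; split; first move=> i.
  by apply: app_inj => x a; rewrite -[LHS]/(app (pr i) x (app h x a)) prE hE.
move=> h' h'P; apply: app_inj => x a; rewrite hE.
apply: functional_extensionality_dep => i; rewrite -h'P -prE //.
Qed.

End Products.

Section DirectLimitGroup.
Variables (K : small) (le : K -> K -> Prop).
Hypothesis dir : directed le.
Variables (V : K -> zmodType) (m : forall k l, le k l -> {additive V k -> V l}).
Hypothesis mM : forall k l n (r : le k l) (r' : le l n) (r'' : le k n) a,
  m r' (m r a) = m r'' a.
Local Open Scope ring_scope.

Definition eventually_equal (p q : {k : K & V k}) : Prop :=
  exists n (r : le (projT1 p) n) (r' : le (projT1 q) n), m r (projT2 p) = m r' (projT2 q).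

Definition dlim : small :=
  {C : {k : K & V k} -> Prop | exists p, C = eventually_equal p}.

Definition dlim_in k (a : V k) : dlim :=
  exist _ (eventually_equal (existT _ k a)) (ex_intro _ _ erefl).

Lemma le_trans k l n : le k l -> le l n -> le k n.
Proof. by have [_ _ tr _] := dir; apply: tr. Qed.

Lemma ub k l : exists n, le k n /\ le l n.
Proof. by have [_ _ _ ub] := dir; apply: ub. Qed.

Lemma dlim_inP k l (a : V k) (b : V l) :
  dlim_in a = dlim_in b <-> eventually_equal (existT _ k a) (existT _ l b).
Proof.
split=> [[e]|].
  rewrite e; have [n [r _]] := ub l l.
  by exists n, r, r.
move=> [n /= [r [r' e]]]; apply: eq_exist; apply/funext => -[j c]; apply/propext.
split=> -[n1 /= [r1 [r1' e1]]]; have [n2 [s s']] := ub n n1.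
  exists n2; exists (le_trans r' s), (le_trans r1' s').
  rewrite /= -(mM r' s) -e -(mM r1' s') -e1.
  by rewrite (mM r s (le_trans r s)) (mM r1 s' (le_trans r s)).
exists n2, (le_trans r s), (le_trans r1' s').
by rewrite /= -(mM r s) e -(mM r1' s') -e1 (mM r' s (le_trans r1 s')) (mM r1 s' (le_trans r1 s')).
Qed.

Lemma dlim_in_map k l (r : le k l) (a : V k) : dlim_in (m r a) = dlim_in a.
Proof.
have [n [s _]] := ub l l.
by apply/dlim_inP; exists n, s, (le_trans r s); rewrite /= (mM _ _ (le_trans r s)).
Qed.

Lemma dlim_onto (q : dlim) : exists k (a : V k), dlim_in a = q.
Proof.
case: q => C h; have [[k a] e] := h; exists k, a.
by apply: eq_exist.
Qed.

Lemma dlim_onto2 (q q' : dlim) : exists k (a b : V k), dlim_in a = q /\ dlim_in b = q'.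
Proof.
have [k [a <-]] := dlim_onto q; have [l [b <-]] := dlim_onto q'.
have [n [r r']] := ub k l; exists n, (m r a), (m r' b).
by rewrite !dlim_in_map.
Qed.

Lemma dlim_in_eq k (a b : V k) : dlim_in a = dlim_in b -> exists n (r : le k n), m r a = m r b.
Proof.
move=> /dlim_inP[n /= [r [r' e]]]; exists n, r; rewrite e; congr (m _ b).
exact: Prop_irrelevance.
Qed.

HB.instance Definition _ := gen_eqMixin dlim.
HB.instance Definition _ := gen_choiceMixin dlim.

Lemma dlim_add_ex (q q' : dlim) : exists t, forall k (a b : V k),
  dlim_in a = q -> dlim_in b = q' -> dlim_in (a + b) = t.
Proof.
have [k [a [b [<- <-]]]] := dlim_onto2 q q'.
exists (dlim_in (a + b)) => l a' b' /dlim_inP[n /= [r [r' e]]] /dlim_inP[n1 /= [r1 [r1' e1]]].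
have [n2 [s s1]] := ub n n1.
apply/dlim_inP; exists n2, (le_trans r s), (le_trans r' s) => /=.
have ea : m (le_trans r s) a' = m (le_trans r' s) a.
  by rewrite -(mM r s) e (mM r' s (le_trans r' s)).
have eb : m (le_trans r s) b' = m (le_trans r' s) b.
  by rewrite -(mM r1 s1) e1 (mM r1' s1 (le_trans r' s)).
by rewrite !raddfD ea eb.
Qed.

Definition dlim_add q q' := sval (cid (dlim_add_ex q q')).

Lemma dlim_inD k (a b : V k) : dlim_in (a + b) = dlim_add (dlim_in a) (dlim_in b).
Proof. exact: (svalP (cid (dlim_add_ex (dlim_in a) (dlim_in b)))). Qed.

Lemma dlim_opp_ex (q : dlim) : exists t, forall k (a : V k),
  dlim_in a = q -> dlim_in (- a) = t.
Proof.
have [k [a <-]] := dlim_onto q.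
exists (dlim_in (- a)) => l a' /dlim_inP[n /= [r [r' e]]].
by apply/dlim_inP; exists n, r, r'; rewrite /= !raddfN e.
Qed.

Definition dlim_opp q := sval (cid (dlim_opp_ex q)).

Lemma dlim_inN k (a : V k) : dlim_in (- a) = dlim_opp (dlim_in a).
Proof. exact: (svalP (cid (dlim_opp_ex (dlim_in a)))). Qed.

Lemma dlim_zero_ex : exists t, forall k, dlim_in (0 : V k) = t.
Proof.
have [[k] _ _ _] := dir; exists (dlim_in (0 : V k)) => l.
have [n [r r']] := ub l k.
by apply/dlim_inP; exists n, r, r'; rewrite /= !raddf0.
Qed.

Definition dlim_zero := sval (cid dlim_zero_ex).

Lemma dlim_in0 k : dlim_in (0 : V k) = dlim_zero.
Proof. exact: (svalP (cid dlim_zero_ex)). Qed.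

Lemma dlim_addA : associative dlim_add.
Proof.
move=> p q t; have [k [a [b [<- <-]]]] := dlim_onto2 p q; have [l [c <-]] := dlim_onto t.
have [n [r r']] := ub k l.
rewrite -(dlim_in_map r a) -(dlim_in_map r b) -(dlim_in_map r' c) -!dlim_inD.
by rewrite addrA.
Qed.

Lemma dlim_addC : commutative dlim_add.
Proof.
by move=> p q; have [k [a [b [<- <-]]]] := dlim_onto2 p q; rewrite -!dlim_inD addrC.
Qed.

Lemma dlim_add0 : left_id dlim_zero dlim_add.
Proof. by move=> p; have [k [a <-]] := dlim_onto p; rewrite -(dlim_in0 k) -dlim_inD add0r. Qed.

Lemma dlim_addN : left_inverse dlim_zero dlim_opp dlim_add.
Proof.
by move=> p; have [k [a <-]] := dlim_onto p; rewrite -dlim_inN -dlim_inD addNr dlim_in0.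
Qed.

HB.instance Definition _ :=
  GRing.isZmodule.Build dlim dlim_addA dlim_addC dlim_add0 dlim_addN.

Definition dlim_group : zmodType := dlim.

Definition dlim_inj k (a : V k) : dlim_group := dlim_in a.

Lemma dlim_inj_zmod k : zmod_morphism (@dlim_inj k).
Proof.
by move=> a b; rewrite /dlim_inj -[RHS]/(dlim_add _ (dlim_opp _)) -dlim_inN -dlim_inD.
Qed.

HB.instance Definition _ k :=
  GRing.isZmodMorphism.Build (V k) dlim_group (@dlim_inj k) (@dlim_inj_zmod k).

Lemma dlim_desc (T : Type) (q : forall k, V k -> T) :
  (forall k l (r : le k l) a, q l (m r a) = q k a) ->
  exists h : dlim_group -> T, forall k a, h (@dlim_inj k a) = q k a.
Proof.
move=> qm.
have /choice[h hP] : forall p : dlim_group, exists t, forall k (a : V k),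
    dlim_inj a = p -> t = q k a.
  move=> p; have [k [a <-]] := dlim_onto p; exists (q k a) => l b /dlim_inP[n /= [r [r' e]]].
  by rewrite -(qm _ _ r') -(qm _ _ r) e.
by exists h => k a; apply: hP.
Qed.

End DirectLimitGroup.

Section DirectLimits.
Variables (A : preaddcat) (K : small) (le : K -> K -> Prop).
Hypothesis dir : directed le.
Variable S : dirsys (funcat A Ab) le.
Local Open Scope ring_scope.

Definition pointwise_dirlim (L : funcat A Ab) (inj : forall k, hom (S k) L) : Prop :=
  forall x, (forall e : el L x, exists k a, app (inj k) x a = e) /\
    (forall k a, app (inj k) x a = 0 -> exists l (r : le k l), app (ds_map S r) x a = 0).

Lemma funcat_dirlim : exists (L : funcat A Ab) (inj : forall k, hom (S k) L),
  is_dirlim inj /\ pointwise_dirlim inj.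
Proof.
pose V x k := el (S k) x.
pose m x k l (r : le k l) : {additive V x k -> V x l} := app (ds_map S r) x.
have mM x k l n (r : le k l) (r' : le l n) (r'' : le k n) a :
    m x _ _ r' (m x _ _ r a) = m x _ _ r'' a.
  exact: (congr1 (fun t : nattrans (S k) (S n) => app t x a) (ds_mapM S r r' r'')).
pose L0 x : zmodType := dlim_group dir (mM x).
pose j x k : {additive V x k -> L0 x} := @dlim_inj _ _ dir _ _ (mM x) k.
have j_onto x (p : L0 x) : exists k (a : V x k), j x k a = p by exact: dlim_onto.
have j_onto2 x (p q : L0 x) : exists k (a b : V x k), j x k a = p /\ j x k b = q.
  exact: dlim_onto2.
have j_map x k l (r : le k l) (a : V x k) : j x l (m x _ _ r a) = j x k a by exact: dlim_in_map.
have ex x y (f : hom x y) : exists h : {additive L0 x -> L0 y},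
    forall k a, h (j x k a) = j y k (act (S k) f a).
  have [|h hE] := @dlim_desc _ _ dir _ _ (mM x) (L0 y) (fun k a => j y k (act (S k) f a)).
    by move=> k l r a; rewrite -(j_map y _ _ r) /m app_act.
  have hB : zmod_morphism h.
    move=> p q; have [k [a [b [<- <-]]]] := j_onto2 x p q.
    by rewrite -raddfB !hE !raddfB.
  pose h' : {additive L0 x -> L0 y} := HB.pack h (GRing.isZmodMorphism.Build _ _ _ hB).
  by exists h'.
pose h x y f := sval (cid (ex x y f)).
have hE x y f k a : h x y f (j x k a) = j y k (act (S k) f a) by exact: (svalP (cid (ex x y f))).
have h1 x : h x x (idm x) = @idm Ab (L0 x).
  by apply: additive_eq => p; have [k [a <-]] := j_onto x p; rewrite hE act1.
have hM x y z (g : hom y z) (f : hom x y) : h x z (g \c f) = (h y z g : @hom Ab _ _) \c h x y f.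
  apply: additive_eq => p; have [k [a <-]] := j_onto x p.
  by rewrite /= !hE act_cmp.
have hD x y (f g : hom x y) : h x y (hadd f g) = @hadd Ab _ _ (h x y f) (h x y g).
  apply: additive_eq => p; have [k [a <-]] := j_onto x p.
  rewrite /= !hE -raddfD; congr (j y k _).
  exact: (congr1 (fun g : {additive _ -> _} => g a) (fmapD (S k) f g)).
pose L : funcat A Ab := @Functor A Ab L0 h h1 hM hD.
have exi k : exists t : nattrans (S k) L, forall x a, app t x a = j x k a.
  apply: nattrans_of => [x a b|x y f a]; first exact: raddfD.
  by rewrite -hE.
pose inj k : hom (S k) L := sval (cid (exi k)).
have injE k x a : app (inj k) x a = j x k a by exact: (svalP (cid (exi k))).
exists L, inj; split; last first.
  move=> x; split; first by move=> e; have [k [a <-]] := j_onto x e; exists k, a.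
  move=> k a; rewrite injE => j0.
  have : j x k a = j x k 0 by rewrite j0 raddf0.
  move=> /(dlim_in_eq dir (mM x))[n [r e]]; exists n, r.
  by rewrite -[LHS]/(m x _ _ r a) e raddf0.
split.
  move=> k l r; apply: app_inj => x a.
  by rewrite -[LHS]/(app (inj l) x (m x _ _ r a)) !injE j_map.
move=> Q q qc.
have exq x : exists t : L0 x -> el Q x, forall k a, t (j x k a) = app (q k) x a.
  apply: (@dlim_desc _ _ dir _ _ (mM x) (el Q x) (fun k a => app (q k) x a)) => k l r a.
  exact: (congr1 (fun t : nattrans (S k) Q => app t x a) (qc k l r)).
pose t x := sval (cid (exq x)).
have tE x k a : t x (j x k a) = app (q k) x a by exact: (svalP (cid (exq x))).
have [| |u uE] := @nattrans_of A L Q t.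
- move=> x p p'; have [k [a [b [<- <-]]]] := j_onto2 x p p'.
  by rewrite -[_ + _]/(j x k a + j x k b) -raddfD !tE raddfD.
- move=> x y f p; have [k [a <-]] := j_onto x p.
  by rewrite -[act L f _]/(h x y f (j x k a)) hE !tE app_act.
exists u; split.
  by move=> k; apply: app_inj => x a; rewrite -[LHS]/(app u x (app (inj k) x a)) injE uE tE.
move=> u' u'P; apply: app_inj => x p; have [k [a <-]] := j_onto x p.
by rewrite uE tE -u'P -injE.
Qed.

End DirectLimits.

(** * Embedding definable categories *)

Section Categories.

Lemma product_eq (C : preaddcat) (I : small) (X : I -> C) (P Q : C)
    (pr : forall i, hom P (X i)) (f g : hom Q P) :
  is_product pr -> (forall i, pr i \c f = pr i \c g) -> f = g.
Proof.
move=> /(_ Q (fun i => pr i \c g))[h [_ hu]] fg.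
by rewrite -(hu f fg); apply: hu.
Qed.

Lemma dirlim_eq (C : preaddcat) (K : small) (le : K -> K -> Prop) (S : dirsys C le)
    (L Q : C) (inj : forall k, hom (S k) L) (f g : hom L Q) :
  is_dirlim inj -> (forall k, f \c inj k = g \c inj k) -> f = g.
Proof.
move=> [co un] fg; have [|h [_ hu]] := un Q (fun k => g \c inj k).
  by move=> k l r; rewrite -cmpA (co k l r).
by rewrite -(hu f fg); apply: hu.
Qed.

Lemma product_iso (C : preaddcat) (I : small) (X : I -> C) (P Q : C)
    (p : forall i, hom P (X i)) (q : forall i, hom Q (X i)) :
  is_product p -> is_product q ->
  exists2 c : hom P Q, is_iso c & forall i, q i \c c = p i.
Proof.
move=> hp hq; have [c [cE _]] := hq P p; have [d [dE _]] := hp Q q.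
exists c => //; exists d; split.
  by apply: (product_eq hp) => i; rewrite cmpA dE cE cmpm1.
by apply: (product_eq hq) => i; rewrite cmpA cE dE cmpm1.
Qed.

Lemma dirlim_iso (C : preaddcat) (K : small) (le : K -> K -> Prop) (S : dirsys C le)
    (L M : C) (p : forall k, hom (S k) L) (q : forall k, hom (S k) M) :
  is_dirlim p -> is_dirlim q ->
  exists2 c : hom L M, is_iso c & forall k, c \c p k = q k.
Proof.
move=> hp hq; have [c [cE _]] := hp.2 M q hq.1; have [d [dE _]] := hq.2 L p hp.1.
exists c => //; exists d; split.
  by apply: (dirlim_eq hp) => k; rewrite -cmpA cE dE cmp1m.
by apply: (dirlim_eq hq) => k; rewrite -cmpA dE cE cmp1m.
Qed.

Definition fully_faithful (A B : preaddcat) (F : functor A B) : Prop :=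
  (forall x y (f g : hom x y), fmap F f = fmap F g -> f = g) /\
  (forall x y (g : hom (F x) (F y)), exists f : hom x y, fmap F f = g).

Lemma is_iso_fmap (A B : preaddcat) (F : functor A B) x y (f : hom x y) :
  is_iso f -> is_iso (fmap F f).
Proof. by move=> [g [gf fg]]; exists (fmap F g); rewrite -!fmapM gf fg !fmap1. Qed.

Lemma iso_cancell (A : preaddcat) (x y z : A) (c : hom y z) (f g : hom x y) :
  is_iso c -> c \c f = c \c g -> f = g.
Proof. by move=> [d [dc _]] e; rewrite -[f]cmp1m -[g]cmp1m -dc -!cmpA e. Qed.

Lemma iso_cancelr (A : preaddcat) (x y z : A) (c : hom x y) (f g : hom y z) :
  is_iso c -> f \c c = g \c c -> f = g.
Proof. by move=> [d [_ cd]] e; rewrite -[f]cmpm1 -[g]cmpm1 -cd !cmpA e. Qed.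

Lemma faithful_of_natiso (A B : preaddcat) (F : functor A B) (F' : functor B A) :
  naturally_iso (fcomp F' F) (fid A) ->
  forall x y (f g : hom x y), fmap F f = fmap F g -> f = g.
Proof.
move=> [t tiso] x y f g fg; apply: (iso_cancelr (tiso x)).
have /= := ntN t f; have /= := ntN t g; rewrite fg => <- <- //.
Qed.

Lemma equivalence_fully_faithful (A B : preaddcat) (F : functor A B) (F' : functor B A) :
  naturally_iso (fcomp F' F) (fid A) -> naturally_iso (fcomp F F') (fid B) ->
  fully_faithful F.
Proof.
move=> t t'; split; first exact: faithful_of_natiso t.
case: t => t tiso x y g.
have [d [_ cd]] := tiso x.
(* The conjugate of [fmap F' g] by [t]; as [F'] is faithful too, naturality of [t] reduces the claim
   to a cancellation. *)
exists (t y \c fmap F' g \c d); apply: (faithful_of_natiso t').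
apply: (iso_cancell (tiso y)).
have /= -> := ntN t (t y \c fmap F' g \c d).
have [e [ed _]] := tiso x.
have -> : d = e by rewrite -[e]cmpm1 -cd cmpA ed cmp1m.
by rewrite -cmpA ed cmpm1.
Qed.

End Categories.

Section Isomorphisms.
Variable A : preaddcat.
Local Open Scope ring_scope.

Lemma app_iso (M N : funcat A Ab) (c : hom M N) : is_iso c ->
  exists d : hom N M, (forall x a, app d x (app c x a) = a) /\
                      (forall x a, app c x (app d x a) = a).
Proof.
move=> [d [dc cd]]; exists d; split=> x a.
  exact: (congr1 (fun t : nattrans M M => app t x a) dc).
exact: (congr1 (fun t : nattrans N N => app t x a) cd).
Qed.

Lemma pointwise_product_iso (I : small) (X : I -> funcat A Ab) (P Q : funcat A Ab)
    (p : forall i, hom P (X i)) (q : forall i, hom Q (X i)) (c : hom P Q) :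
  is_iso c -> (forall i, q i \c c = p i) -> pointwise_product q -> pointwise_product p.
Proof.
move=> /app_iso[d [dc cd]] qc pw x; have [ex un] := pw x.
have E i a : app (p i) x a = app (q i) x (app c x a) by rewrite -(qc i).
split=> [u|a a0].
  by have [b bE] := ex u; exists (app d x b) => i; rewrite E cd.
by rewrite -(dc x a) (un (app c x a)) ?raddf0 // => i; rewrite -E.
Qed.

Lemma pointwise_dirlim_iso (K : small) (le : K -> K -> Prop) (S : dirsys (funcat A Ab) le)
    (L M : funcat A Ab) (p : forall k, hom (S k) L) (q : forall k, hom (S k) M)
    (c : hom L M) :
  is_iso c -> (forall k, c \c p k = q k) -> pointwise_dirlim p -> pointwise_dirlim q.
Proof.
move=> /app_iso[d [dc cd]] cp pw x; have [onto ker] := pw x.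
have E k a : app (q k) x a = app c x (app (p k) x a) by rewrite -(cp k).
split=> [e|k a].
  by have [k [a ae]] := onto (app d x e); exists k, a; rewrite E ae cd.
by rewrite E => a0; apply: ker; rewrite -[LHS]dc a0 raddf0.
Qed.

End Isomorphisms.

(* What is used of a definable category [D]: an embedding [J] in a module
   category whose composites with evaluations preserve and create limits. *)
Record concrete_embedding (D R : preaddcat) (J : functor D (Mod R)) : Prop :=
  ConcreteEmbedding {
  emb_ff : fully_faithful J;
  emb_product : forall (I : small) (X : I -> D),
    exists (P : D) (pr : forall i, hom P (X i)), is_product pr;
  emb_dirlim : forall (K : small) (le : K -> K -> Prop), directed le ->
    forall S : dirsys D le,
    exists (L : D) (inj : forall k, hom (S k) L), is_dirlim inj;
  emb_productE : forall (I : small) (X : I -> D) (P : D) (pr : forall i, hom P (X i)),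
    is_product pr -> pointwise_product (fun i => fmap J (pr i));
  emb_dirlimE : forall (K : small) (le : K -> K -> Prop), directed le ->
    forall (S : dirsys D le) (L : D) (inj : forall k, hom (S k) L),
    is_dirlim inj -> @pointwise_dirlim _ K le (fdirsys J S) (J L) (fun k => fmap J (inj k))
}.

(** Limits are formed in [Mod R], lie in [P] by closure, and are carried back to [D] by essential
    surjectivity. Any other product or direct limit in [D] is isomorphic to the one so constructed,
    hence is pointwise as well. *)
Lemma definable_embedding (D : preaddcat) : definable D ->
  exists R : preaddcat, skeletally_small R /\
  exists J : functor D (Mod R), concrete_embedding J.
Proof.
move=> [R [sR [P [[cP cL _] [E [E' [iE iE']]]]]]]; exists R; split=> //.
pose J : functor D (Mod R) := fcomp (incl P) E.
have ffE := equivalence_fully_faithful iE iE'.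
have ff : fully_faithful J by [].
have JP x : P (J x) := svalP (E x).
have ess M : P M -> exists Q (w : hom (J Q) M), is_iso w.
  move=> PM; case: iE' => t tiso; pose M' : full_sub P := exist _ M PM.
  by exists (E' M'), (t M'); exact: (tiso M').
have prodE (I : small) (X : I -> D) : exists (Q : D) (q : forall i, hom Q (X i)),
    is_product q /\ pointwise_product (fun i => fmap J (q i)).
  have [P0 [pr0 [h0 pw0]]] := funcat_product (fun i => J (X i)).
  have [Q [w wiso]] := ess P0 (cP _ _ _ _ h0 (fun i => JP (X i))).
  have ex i : exists q : hom Q (X i), fmap J q = pr0 i \c w by exact: (ff.2 Q (X i)).
  pose q i := sval (cid (ex i)).
  have qE i : fmap J (q i) = pr0 i \c w by exact: (svalP (cid (ex i))).
  exists Q, q; split; last first.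
    by apply: (pointwise_product_iso wiso _ pw0) => i; rewrite qE.
  move=> Q' q'; have [h [hE _]] := h0 (J Q') (fun i => fmap J (q' i)).
  have [w' [w'w ww']] := wiso; have [k kE] := ff.2 Q' Q (w' \c h).
  have key i : q i \c k = q' i.
    by apply: ff.1; rewrite fmapM kE qE -cmpA (cmpA w) ww' cmp1m hE.
  exists k; split=> // k' k'E; apply: ff.1; apply: (iso_cancell wiso).
  by apply: (product_eq h0) => i; rewrite !cmpA -qE -!fmapM key k'E.
have limE (K : small) (le : K -> K -> Prop) (dir : directed le) (S : dirsys D le) :
    exists (L : D) (q : forall k, hom (S k) L), is_dirlim q /\
      @pointwise_dirlim _ K le (fdirsys J S) (J L) (fun k => fmap J (q k)).
  have [L0 [inj0 [h0 pw0]]] := funcat_dirlim dir (fdirsys J S).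
  have [Q [w wiso]] := ess L0 (cL _ _ dir _ _ _ h0 (fun k => JP (S k))).
  have [w' [w'w ww']] := wiso.
  have w'iso : is_iso w' by exists w.
  have ex k : exists q : hom (S k) Q, fmap J q = w' \c inj0 k by exact: (ff.2 (S k) Q).
  pose q k := sval (cid (ex k)).
  have qE k : fmap J (q k) = w' \c inj0 k by exact: (svalP (cid (ex k))).
  exists Q, q; split; last first.
    by apply: (pointwise_dirlim_iso w'iso _ pw0) => k; rewrite qE.
  split.
    by move=> k l r; apply: ff.1; rewrite fmapM !qE -cmpA; congr (_ \c _); exact: h0.1.
  move=> Q' q' q'c.
  have [|h [hE _]] := h0.2 (J Q') (fun k => fmap J (q' k)).
    by move=> k l r; rewrite -[RHS](congr1 (fmap J) (q'c k l r)) fmapM.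
  have [k kE] := ff.2 Q Q' (h \c w).
  have key i : k \c q i = q' i.
    by apply: ff.1; rewrite fmapM kE qE cmpA -(cmpA h) ww' cmpm1 hE.
  exists k; split=> // k' k'E; apply: ff.1; apply: (iso_cancelr w'iso).
  by apply: (dirlim_eq h0) => i; rewrite -!cmpA -qE -!fmapM key k'E.
exists J; split=> //.
- by move=> I X; have [Q [q [h _]]] := prodE I X; exists Q, q.
- by move=> K le dir S; have [Q [q [h _]]] := limE K le dir S; exists Q, q.
- move=> I X Q' q' h'; have [Q [q [h pw]]] := prodE I X.
  have [c ciso cE] := product_iso h' h.
  by apply: (pointwise_product_iso (is_iso_fmap J ciso) _ pw) => i; rewrite -fmapM cE.
- move=> K le dir S Q' q' h'; have [Q [q [h pw]]] := limE K le dir S.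
  have [c ciso cE] := dirlim_iso h h'.
  by apply: (pointwise_dirlim_iso (is_iso_fmap J ciso) _ pw) => k; rewrite -fmapM cE.
Qed.

(** * Ultrapowers in definable categories *)

Section UltrapowerCategory.
Variables (D : preaddcat) (I : small) (U : set_system I).
Hypothesis FU : Filter U.

Lemma revincl_directed : directed (@revincl I U).
Proof.
split.
- by constructor; exists setT; exact: filterT.
- by move=> J i.
- by move=> J J' J'' s s' i /s'/s.
- move=> [J UJ] [J' UJ']; exists (exist _ (J `&` J') (filterI UJ UJ')).
  by split=> i [].
Qed.

Definition whole : {J : I -> Prop | U J} := exist _ setT filterT.

Definition is_diagonal (X : D) (A : ultrapower U X) (d : hom X (up_ob A)) : Prop :=
  exists J (dJ : hom X (up_sys A J)),
    (forall i, up_pr A J i \c dJ = idm X) /\ d = up_inj A J \c dJ.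

Lemma diagonal_exists (X : D) (A : ultrapower U X) : exists d, is_diagonal (A := A) d.
Proof.
pose T := whole; have [dT [dTE _]] := up_prod A (J := T) (fun i => idm X).
by exists (up_inj A T \c dT), T, dT.
Qed.

Lemma ultrapower_map_exists (X Y : D) (A : ultrapower U X) (B : ultrapower U Y)
    (f : hom X Y) : exists h, is_ultrapower_map f (A := A) (B := B) h.
Proof.
have ex J : exists fJ : hom (up_sys A J) (up_sys B J),
    forall i, up_pr B J i \c fJ = f \c up_pr A J i.
  by have [fJ [fJE _]] := up_prod B (J := J) (fun i => f \c up_pr A J i); exists fJ.
pose fJ J := sval (cid (ex J)).
have fJE J i : up_pr B J i \c fJ J = f \c up_pr A J i by exact: (svalP (cid (ex J))).
have [|h [hE _]] := (up_lim A).2 (up_ob B) (fun J => up_inj B J \c fJ J); last first.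
  by exists h => J; exists (fJ J).
move=> J J' r.
have -> : up_inj B J = up_inj B J' \c ds_map (up_sys B) r by rewrite (up_lim B).1.
rewrite -!cmpA; congr (_ \c _); apply: (product_eq (up_prod B (J := J'))) => -[i Hi].
by rewrite !cmpA fJE up_restr fJE -cmpA up_restr.
Qed.

End UltrapowerCategory.

Section UltrapowerElements.
Variables (D R : preaddcat) (J : functor D (Mod R)).
Hypothesis emb : concrete_embedding J.

Lemma ultrapower_exists (I : small) (U : set_system I) (FU : Filter U) (X : D) :
  inhabited (ultrapower U X).
Proof.
have exP (H : {H : I -> Prop | U H}) : exists P : {P : D & forall i : {i | sval H i}, hom P X},
    @is_product D {i | sval H i} (fun=> X) (projT1 P) (projT2 P).
  by have [P [pr h]] := emb_product emb (fun _ : {i | sval H i} => X); exists (existT _ P pr).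
pose P H := projT1 (sval (cid (exP H))).
pose pr H : forall i, hom (P H) X := projT2 (sval (cid (exP H))).
have prP H : @is_product D {i | sval H i} (fun=> X) (P H) (@pr H) by exact: (svalP (cid (exP H))).
have exm H H' (r : revincl H H') : exists m : hom (P H) (P H'),
    forall i (Hi : sval H' i), pr H' (exist _ i Hi) \c m = pr H (exist _ i (r i Hi)).
  have [m [mE _]] := prP H' (P H) (fun i => pr H (exist _ (sval i) (r _ (proj2_sig i)))).
  by exists m => i Hi; rewrite mE.
pose m H H' r := sval (cid (exm H H' r)).
have mE H H' r i (Hi : sval H' i) : pr H' (exist _ i Hi) \c m H H' r = pr H (exist _ i (r i Hi)).
  exact: (svalP (cid (exm H H' r))).
have m1 H (r : revincl H H) : m H H r = idm (P H).
  apply: (product_eq (prP H)) => -[i Hi]; rewrite mE cmpm1; congr (pr H (exist _ i _)).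
  exact: Prop_irrelevance.
have mM H H' H'' (r : revincl H H') (s : revincl H' H'') (t : revincl H H'') :
    m _ _ s \c m _ _ r = m _ _ t.
  apply: (product_eq (prP H'')) => -[i Hi]; rewrite cmpA !mE.
  by congr (pr H (exist _ i _)); exact: Prop_irrelevance.
have [L [inj h]] := emb_dirlim emb (revincl_directed FU) (DirSys m1 mM).
by constructor; apply: (@Ultrapower D I U X (DirSys m1 mM) pr prP mE L inj h).
Qed.

Variables (I : small) (U : set_system I).
Hypothesis FU : Filter U.
Local Open Scope ring_scope.

Definition represents (X : D) (A : ultrapower U X) x (u : I -> el (J X) x)
    (e : el (J (up_ob A)) x) : Prop :=
  exists H p, (forall i, app (fmap J (up_pr A H i)) x p = u (sval i)) /\
    app (fmap J (up_inj A H)) x p = e.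

Lemma represents_uniq (X : D) (A : ultrapower U X) x (u : I -> el (J X) x) e e' :
  represents (A := A) u e -> represents (A := A) u e' -> e = e'.
Proof.
have restr H H' (r : revincl H H') p :
    (forall i, app (fmap J (up_pr A H i)) x p = u (sval i)) ->
    (forall i, app (fmap J (up_pr A H' i)) x (app (fmap J (ds_map (up_sys A) r)) x p) =
               u (sval i)) /\
    app (fmap J (up_inj A H')) x (app (fmap J (ds_map (up_sys A) r)) x p) =
      app (fmap J (up_inj A H)) x p.
  move=> pE; split.
    move=> [i Hi] /=; rewrite -[LHS]/(app (fmap J (up_pr A H' (exist _ i Hi)) \c
      fmap J (ds_map (up_sys A) r)) x p).
    by rewrite -fmapM up_restr pE.
  rewrite -[LHS]/(app (fmap J (up_inj A H') \c fmap J (ds_map (up_sys A) r)) x p) -fmapM.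
  by rewrite (up_lim A).1.
move=> [H [p [pE <-]]] [H' [p' [pE' <-]]].
have [_ _ _ ub] := revincl_directed FU; have [H2 [r r']] := ub H H'.
have [qE <-] := restr _ _ r _ pE; have [qE' <-] := restr _ _ r' _ pE'.
congr (app _ x _); apply/subr0_eq.
apply: (emb_productE emb (up_prod A (J := H2)) x).2 => i.
by rewrite raddfB qE qE' subrr.
Qed.

Lemma represents_ex (X : D) (A : ultrapower U X) x (u : I -> el (J X) x) :
  exists e, represents (A := A) u e.
Proof.
pose T := whole FU.
have [p pE] := (emb_productE emb (up_prod A (J := T)) x).1 (fun i => u (sval i)).
by exists (app (fmap J (up_inj A T)) x p), T, p.
Qed.

Definition class_of (X : D) (A : ultrapower U X) x (u : I -> el (J X) x) :
  el (J (up_ob A)) x := sval (cid (represents_ex A u)).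

Lemma class_ofP (X : D) (A : ultrapower U X) x (u : I -> el (J X) x) :
  represents u (class_of A u).
Proof. exact: (svalP (cid (represents_ex A u))). Qed.

Lemma class_ofE (X : D) (A : ultrapower U X) x (u : I -> el (J X) x) e :
  represents (A := A) u e -> class_of A u = e.
Proof. exact: represents_uniq (class_ofP A u). Qed.

Lemma class_of_lift (X : D) (A : ultrapower U X) x (u : I -> el (J X) x) :
  exists p, let T := whole FU in
    (forall i, app (fmap J (up_pr A T i)) x p = u (sval i)) /\
    app (fmap J (up_inj A T)) x p = class_of A u.
Proof.
pose T := whole FU.
have [p pE] := (emb_productE emb (up_prod A (J := T)) x).1 (fun i => u (sval i)).
by exists p; split=> //; apply: esym; apply: class_ofE; exists T, p.
Qed.

(** The delicate half of [cls0]: an element of the full power that dies in the direct limit already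
    vanishes after restriction to some [H] in [U], hence at all coordinates in [H]. *)
Lemma is_class_map_class_of (X : D) (A : ultrapower U X) : is_class_map U (@class_of X A).
Proof.
pose T := whole FU.
split.
- move=> x e.
  have [H [p <-]] := (emb_dirlimE emb (revincl_directed FU) (up_lim A) x).1 e.
  exists (fun i => if pselect (sval H i) is left Hi
    then app (fmap J (up_pr A H (exist _ i Hi))) x p else 0).
  apply: class_ofE; exists H, p; split=> // -[i Hi] /=.
  case: pselect => // Hi'; congr (app (fmap J (up_pr A H (exist _ i _))) x p).
  exact: Prop_irrelevance.
- move=> x u v; have [p [pE <-]] := class_of_lift A u; have [q [qE <-]] := class_of_lift A v.
  by apply: class_ofE; exists T, (p + q); split=> [i|]; rewrite !raddfD ?pE ?qE.
- move=> x u; have [p [pE <-]] := class_of_lift A u; split=> [p0|Uu].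
    have [H [r mp0]] := (emb_dirlimE emb (revincl_directed FU) (up_lim A) x).2 T p p0.
    have : U (sval H) by exact: svalP H.
    apply: filterS => i Hi /=.
    rewrite -[u i]/(u (sval (exist (sval T) i (r i Hi)))) -pE -(up_restr A r) fmapM.
    by rewrite -[LHS]/(app (fmap J (up_pr A H (exist _ i Hi))) x
      (app (fmap J (ds_map (up_sys A) r)) x p)) mp0 raddf0.
  apply: (@represents_uniq X A x u); first by exists T, p.
  exists (exist _ _ Uu), 0; split; last by rewrite raddf0.
  by move=> [i /= ui]; rewrite raddf0 ui.
- move=> x y f u; have [p [pE <-]] := class_of_lift A u.
  apply: esym; apply: class_ofE; exists T, (act _ f p); split=> [i|]; last exact: app_act.
  by rewrite app_act pE.
Qed.

Lemma class_of_map (X Y : D) (A : ultrapower U X) (B : ultrapower U Y) (f : hom X Y)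
    (h : hom (up_ob A) (up_ob B)) x (u : I -> el (J X) x) : is_ultrapower_map f h ->
  app (fmap J h) x (class_of A u) = class_of B (fun i => app (fmap J f) x (u i)).
Proof.
pose T := whole FU.
move=> /(_ T)[fT [fTE hE]]; have [p [pE <-]] := class_of_lift A u.
apply: esym; apply: class_ofE; exists T, (app (fmap J fT) x p); split=> [i|].
  rewrite -pE -[LHS]/(app (fmap J (up_pr B T i) \c fmap J fT) x p) -fmapM fTE fmapM //.
rewrite -[LHS]/(app (fmap J (up_inj B T) \c fmap J fT) x p) -fmapM -hE fmapM //.
Qed.

Lemma class_of_diagonal (X : D) (A : ultrapower U X) (d : hom X (up_ob A)) x (a : el (J X) x) :
  is_diagonal d -> app (fmap J d) x a = class_of A (fun=> a).
Proof.
move=> [H [dH [dHE ->]]]; apply: esym; apply: class_ofE.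
exists H, (app (fmap J dH) x a); split=> [i|]; last by rewrite fmapM.
by rewrite -[LHS]/(app (fmap J (up_pr A H i) \c fmap J dH) x a) -fmapM dHE fmap1.
Qed.

End UltrapowerElements.

(** * Enough pure-injectives *)

Section Purity.
Variables (D R : preaddcat) (J : functor D (Mod R)).
Hypothesis emb : concrete_embedding J.
Local Open Scope ring_scope.

Lemma emb_inj (X Y : D) (f g : hom X Y) :
  (forall x, app (fmap J f) x =1 app (fmap J g) x) -> f = g.
Proof. by move=> fg; apply: (emb_ff emb).1; apply: app_inj. Qed.

Lemma app_cmp (X Y Z : D) (g : hom Y Z) (f : hom X Y) x a :
  app (fmap J (g \c f)) x a = app (fmap J g) x (app (fmap J f) x a).
Proof. by rewrite fmapM. Qed.

Lemma app_idm (X : D) x a : app (fmap J (idm X)) x a = a.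
Proof. by rewrite fmap1. Qed.

Section Diagonal.
Variables (I : small) (U : set_system I).
Hypothesis UU : ProperFilter U.

Lemma class_of_inj (X Y : D) (B : ultrapower U Y) (f : hom X Y) x (u : I -> el (J X) x) b :
  class_of emb UU B (fun=> b) = class_of emb UU B (fun i => app (fmap J f) x (u i)) ->
  exists a, app (fmap J f) x a = b.
Proof.
move=> /(cls_eq (is_class_map_class_of emb UU B))/filter_ex[i /= e].
by exists (u i).
Qed.

Lemma diagonal_natural (X Y : D) (A : ultrapower U X) (B : ultrapower U Y) (f : hom X Y)
    (h : hom (up_ob A) (up_ob B)) (dX : hom X (up_ob A)) (dY : hom Y (up_ob B)) :
  is_ultrapower_map f h -> is_diagonal dX -> is_diagonal dY -> dY \c f = h \c dX.
Proof.
move=> hf dXd dYd; apply: emb_inj => x a.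
rewrite !app_cmp (class_of_diagonal emb UU _ dXd) (class_of_diagonal emb UU _ dYd).
by rewrite (class_of_map emb UU _ hf).
Qed.

Lemma diagonal_monic (X : D) (A : ultrapower U X) (d : hom X (up_ob A)) :
  is_diagonal d -> monic d.
Proof.
move=> dd Q f g dfg; apply: emb_inj => x a.
have := congr1 (fun t => app (fmap J t) x a) dfg.
rewrite !app_cmp !(class_of_diagonal emb UU _ dd).
by move=> /(cls_eq (is_class_map_class_of emb UU A))/filter_ex[i].
Qed.

(* An element [y] with [dN y = h (r (dN y))] is almost everywhere, hence
   somewhere, in the image of [f]. *)
Lemma factor_through (X N Q : D) (A : ultrapower U X) (B : ultrapower U N) (f : hom X N)
    (h : hom (up_ob A) (up_ob B)) (r : hom (up_ob B) (up_ob A)) (dN : hom N (up_ob B))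
    (y : hom Q N) :
  is_ultrapower_map f h -> r \c h = idm (up_ob A) -> is_diagonal dN ->
  dN \c y = h \c (r \c (dN \c y)) -> exists z : hom Q X, f \c z = y.
Proof.
move=> hf rh dNd hy.
(* Injectivity on elements comes from the retraction [r] of [h]; it makes the preimages [z] unique,
   hence additive and natural. *)
have f_inj x : injective (app (fmap J f) x).
  move=> a b ab.
  have : class_of emb UU B (fun=> app (fmap J f) x a) =
         class_of emb UU B (fun=> app (fmap J f) x b) by rewrite ab.
  rewrite -!(class_of_map emb UU (fun=> _) hf).
  move=> /(congr1 (app (fmap J r) x)); rewrite -!app_cmp rh !app_idm.
  by move=> /(cls_eq (is_class_map_class_of emb UU A))/filter_ex[i].
have ex x (q : el (J Q) x) : exists a, app (fmap J f) x a = app (fmap J y) x q.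
  have [u uE] := cls_surj (is_class_map_class_of emb UU A) (app (fmap J (r \c (dN \c y))) x q).
  apply: (@class_of_inj X N B f x u); rewrite -(class_of_map emb UU _ hf) uE -app_cmp -hy.
  by rewrite app_cmp (class_of_diagonal emb UU _ dNd).
pose z x q := sval (cid (ex x q)).
have zE x q : app (fmap J f) x (z x q) = app (fmap J y) x q by exact: (svalP (cid (ex x q))).
have [| |t tE] := @nattrans_of _ (J Q) (J X) z.
- by move=> x a b; apply: f_inj; rewrite raddfD !zE raddfD.
- by move=> x x' g a; apply: f_inj; rewrite app_act !zE app_act.
have [k kE] := (emb_ff emb).2 Q X t.
exists k; apply: emb_inj => x a.
by rewrite app_cmp kE tE zE.
Qed.

End Diagonal.

Lemma op_isomorphic (x y : R) : isomorphic x y -> @isomorphic (opcat R) x y.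
Proof. by move=> [f [g [gf fg]]]; exists g, f. Qed.

(* The ultrapower by a good ultrafilter is pure-injective, and the diagonal
   into it becomes split after passing to ultrapowers once more. *)
Lemma enough_pure_injectives (X : D) : skeletally_small R ->
  exists (N : D) (f : hom X N), pure_mono f /\ pure_injective D N.
Proof.
move=> [_ [S [s sP]]].
have s_onto (x : opcat R) : exists i, @isomorphic (opcat R) (s i) x.
  by have [i /op_isomorphic h] := sP x; exists i.
(* A subset of the disjoint union of the groups of [X] over the skeleton codes a subset of each of
   them, so a single [Phi] serves every [i]. *)
pose Phi : small := {i : S & el (J X) (s i)} -> Prop.
have [I [W [UW good]]] := good_ultrafilter Phi.
have onto i : exists d : Phi -> (el (J X) (s i) -> Prop), forall Y, exists p, d p = Y.
  exists (fun p a => p (existT _ i a)) => Y.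
  exists (fun t => forall e : projT1 t = i, Y (eq_rect _ (fun j => el (J X) (s j)) (projT2 t) _ e)).
  apply/funext => a; apply/propext; split=> [/(_ erefl) //|Ya /= e].
  by rewrite (Prop_irrelevance e erefl).
have PW : ProperFilter W by exact: ultra_proper.
have [A] := ultrapower_exists emb PW X.
have cA := is_class_map_class_of emb PW A.
pose N := up_ob A.
(* Used twice: on the ultrapower of [d], to make [d] pure, and on diagonals of [N], to make [N]
   pure-injective. *)
have split (Y : D) (f : hom N Y) : locally_pure (A := opcat R) s (fmap J f) -> split_mono f.
  move=> lp; have [t tf] := locally_pure_split PW s_onto cA good onto lp.
  have [r rE] := (emb_ff emb).2 Y N t.
  by exists r; apply: (emb_ff emb).1; rewrite fmapM rE fmap1.
have lpd (I' : small) (U : set_system I') (PU : ProperFilter U) (Y : D) (B : ultrapower U Y)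
    (d : hom Y (up_ob B)) : is_diagonal d -> locally_pure (A := opcat R) s (fmap J d).
  move=> dd; apply: (locally_pure_diagonal PU (is_class_map_class_of emb PU B)) => x a.
  exact: class_of_diagonal.
have [d dd] := diagonal_exists PW A.
have [B] := ultrapower_exists emb PW N.
have [h hd] := ultrapower_map_exists A B d.
exists N, d; split.
  split; first exact: diagonal_monic PW _ _ _ dd.
  exists I, W; split=> //; exists A, B, h; split=> //; apply: split.
  apply: (locally_pure_ultrapower PW cA (is_class_map_class_of emb PW B) _ (lpd _ _ _ _ _ _ dd)).
  by move=> x u; apply: class_of_map.
move=> Y Z f [_ [I' [U [UU [A' [B' [k [kf [r rk]]]]]]]]] g.
have PU : ProperFilter U by exact: ultra_proper.
have [A''] := ultrapower_exists emb PU N.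
have [g' g'g] := ultrapower_map_exists A' A'' g.
have [dY dYd] := diagonal_exists PU A'.
have [dZ dZd] := diagonal_exists PU B'.
have [dN dNd] := diagonal_exists PU A''.
have [t tdN] := split _ _ (lpd _ _ _ _ _ _ dNd).
(* The extension goes from [Z] to its ultrapower, by [r] to that of [Y], along [g'] to that of [N],
   and down by the retraction [t] of the diagonal. *)
exists (t \c g' \c r \c dZ).
rewrite -(cmpA _ dZ) (diagonal_natural PU kf dYd dZd) (cmpA _ k) -(cmpA _ r) rk cmpm1.
by rewrite -cmpA -(diagonal_natural PU g'g dYd dNd) cmpA tdN cmp1m.
Qed.

End Purity.

(** * Preservation of ultrapowers by functors commuting with products and direct limits *)

Section Preservation.
Variables (D C : preaddcat) (F : functor D C).
Hypothesis mF : DEF_morphism F.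
Variables (I : small) (U : set_system I).
Hypothesis FU : Filter U.

Lemma fmap_up_restr (X : D) (A : ultrapower U X) (J J' : {J : I -> Prop | U J})
    (r : revincl J J') i (Hi : sval J' i) :
  fmap F (up_pr A J' (exist _ i Hi)) \c ds_map (fdirsys F (up_sys A)) r =
  fmap F (up_pr A J (exist _ i (r i Hi))).
Proof. by rewrite /= -fmapM up_restr. Qed.

Definition map_ultrapower (X : D) (A : ultrapower U X) : ultrapower U (F X) :=
  @Ultrapower C I U (F X) (fdirsys F (up_sys A)) (fun J i => fmap F (up_pr A J i))
    (fun J => mF.1 _ _ _ _ (up_prod A (J := J))) (@fmap_up_restr X A)
    (F (up_ob A)) (fun J => fmap F (up_inj A J))
    (mF.2 _ _ (revincl_directed FU) _ _ _ (up_lim A)).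

Lemma map_is_diagonal (X : D) (A : ultrapower U X) (d : hom X (up_ob A)) :
  is_diagonal d -> is_diagonal (A := map_ultrapower A) (fmap F d).
Proof.
move=> [J [dJ [dJE ->]]]; exists J, (fmap F dJ); split; last exact: fmapM.
by move=> i; rewrite /= -fmapM dJE fmap1.
Qed.

Lemma map_is_ultrapower_map (X Y : D) (A : ultrapower U X) (B : ultrapower U Y)
    (f : hom X Y) (h : hom (up_ob A) (up_ob B)) : is_ultrapower_map f h ->
  is_ultrapower_map (A := map_ultrapower A) (B := map_ultrapower B) (fmap F f) (fmap F h).
Proof.
move=> hf J; have [fJ [fJE hE]] := hf J; exists (fmap F fJ); split.
  by move=> i; rewrite /= -!fmapM fJE.
by rewrite /= -!fmapM hE.
Qed.

End Preservation.

Lemma definable_enough_pure_injectives (D : preaddcat) (defD : definable D) (X : D) :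
  exists (N : D) (f : hom X N), pure_mono f /\ pure_injective D N.
Proof.
have [R [sR [J emb]]] := definable_embedding defD.
exact: enough_pure_injectives emb X sR.
Qed.

(** * Extension of natural transformations *)

Section Extension.
Variables (D C : preaddcat) (defD : definable D) (defC : definable C).
Implicit Types F G : functor D C.

(** The monic diagonal of [G X] factors through [fmap G f]: it is the composite of [fmap G f], the
    diagonal of [G N] and [fmap G r]. *)
Lemma DEF_pure_mono_monic G (mG : DEF_morphism G) X N (f : hom X N) :
  pure_mono f -> monic (fmap G f).
Proof.
move=> [_ [I [U [UU [A [B [h [hf [r rh]]]]]]]]] Q u v fuv.
have [R [_ [J emb]]] := definable_embedding defC.
have PU : ProperFilter U by exact: ultra_proper.
have [dX /(map_is_diagonal mG PU) dXd] := diagonal_exists PU A.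
have [dN /(map_is_diagonal mG PU) dNd] := diagonal_exists PU B.
have nat := diagonal_natural emb PU (map_is_ultrapower_map mG PU hf) dXd dNd.
apply: (diagonal_monic emb PU dXd).
have rGh : fmap G r \c fmap G h = idm (G (up_ob A)) by rewrite -fmapM rh fmap1.
rewrite -[fmap G dX]cmp1m -rGh -(cmpA _ (fmap G h)).
have -> : fmap G h \c fmap G dX = fmap G dN \c fmap G f by exact: esym nat.
by rewrite -!cmpA fuv.
Qed.

Lemma hadd_hopp (B : preaddcat) (x y : B) (f g : hom x y) :
  hadd f (hopp g) = hzero x y -> f = g.
Proof. by move=> e; apply: (haddI (f := hopp g)); rewrite haddC e haddN. Qed.

Lemma fmap_hzero (A B : preaddcat) (F : functor A B) x y :
  fmap F (hzero x y) = hzero (F x) (F y).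
Proof.
apply: (haddI (f := fmap F (hzero x y))).
by rewrite -fmapD hadd0 haddC hadd0.
Qed.

Section Component.
Variables (F G : functor D C) (mG : DEF_morphism G).
Variable t : nattrans (frestr F (pure_injective D)) (frestr G (pure_injective D)).

Lemma restr_natural N N' (hN : pure_injective D N) (hN' : pure_injective D N') (g : hom N N') :
  t (exist _ N' hN') \c fmap F g = fmap G g \c t (exist _ N hN).
Proof. exact: (@ntN _ _ _ _ t (exist _ N hN) (exist _ N' hN') g). Qed.

(* With [h : A -> B] an ultrapower of [f] and [r] a retraction of [h], the map
   [k = dN - h r dN : N -> B] kills [f].  Embedding [B] purely in a
   pure-injective object, naturality of [t] shows that [G k] kills [t N \c F f],
   which therefore factors through [G f]. *)
Lemma component_exists X N (f : hom X N) (hN : pure_injective D N) : pure_mono f ->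
  exists z : hom (F X) (G X), fmap G f \c z = t (exist _ N hN) \c fmap F f.
Proof.
move=> [_ [I [U [UU [A [B [h [hf [r rh]]]]]]]]].
have PU : ProperFilter U by exact: ultra_proper.
have [dX dXd] := diagonal_exists PU A; have [dN dNd] := diagonal_exists PU B.
have [R [_ [J emb]]] := definable_embedding defD.
have nat := diagonal_natural emb PU hf dXd dNd.
pose k := hadd dN (hopp (h \c (r \c dN))).
have kf : k \c f = hzero X (up_ob B).
  rewrite /k cmpDl cmpNm -!cmpA nat (cmpA r) rh cmp1m.
  by rewrite haddC haddN.
have [N' [e [pe hN']]] := definable_enough_pure_injectives defD (up_ob B).
pose y := t (exist _ N hN) \c fmap F f.
have ky : fmap G k \c y = hzero _ _.
  (* Naturality of [t] applies to [e \c k], which runs between pure-injectives, whereas the target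
     of [k] need not be one; the monic [fmap G e] is then cancelled. *)
  apply: (DEF_pure_mono_monic mG pe); rewrite cmpm0 cmpA -fmapM /y cmpA.
  by rewrite -restr_natural -cmpA -fmapM -cmpA kf cmpm0 fmap_hzero cmpm0.
have [R' [_ [J' emb']]] := definable_embedding defC.
have rGh : fmap G r \c fmap G h = idm (G (up_ob A)) by rewrite -fmapM rh fmap1.
apply: (factor_through emb' PU (map_is_ultrapower_map mG PU hf) rGh (map_is_diagonal mG PU dNd)).
apply: hadd_hopp; rewrite -ky /k fmapD cmpDl; congr (hadd _ _).
have -> : fmap G (hopp (h \c (r \c dN))) = hopp (fmap G (h \c (r \c dN))).
  by apply: hopp_eq; rewrite -fmapD haddN fmap_hzero.
by rewrite cmpNm !fmapM !cmpA.
Qed.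

End Component.

Lemma nattrans_restr_inj F G (mG : DEF_morphism G) (s t : nattrans F G) :
  ntrestr s (pure_injective D) = ntrestr t (pure_injective D) -> s = t.
Proof.
move=> st; apply: nattrans_eq => X.
have [N [f [pf hN]]] := definable_enough_pure_injectives defD X.
apply: (DEF_pure_mono_monic mG pf); rewrite -!ntN.
have /= -> := congr1 (fun u : nattrans (frestr F _) (frestr G _) => u (exist _ N hN)) st.
by [].
Qed.

(** Naturality at [g : X -> Y]: since [N Y] is pure-injective, [f Y \c g] extends along [f X] to
    some [g'], and the square for [g'] gives that for [g] after cancelling [fmap G (f Y)]. *)
Lemma nattrans_extend F G (mG : DEF_morphism G)
    (t : nattrans (frestr F (pure_injective D)) (frestr G (pure_injective D))) :
  exists s : nattrans F G, ntrestr s (pure_injective D) = t.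
Proof.
pose enough := definable_enough_pure_injectives defD.
pose N X := sval (cid (enough X)).
pose f X : hom X (N X) := sval (cid (svalP (cid (enough X)))).
have [pf hN] : (forall X, pure_mono (f X)) /\ (forall X, pure_injective D (N X)).
  by split=> X; have [] := svalP (cid (svalP (cid (enough X)))).
have ex X := component_exists mG t (hN X) (pf X).
pose z X := sval (cid (ex X)).
have zE X : fmap G (f X) \c z X = t (exist _ (N X) (hN X)) \c fmap F (f X).
  exact: (svalP (cid (ex X))).
have nat X Y (g : hom X Y) : z Y \c fmap F g = fmap G g \c z X.
  apply: (DEF_pure_mono_monic mG (pf Y)).
  have [g' g'E] := hN Y _ _ _ (pf X) (f Y \c g).
  rewrite cmpA zE -(cmpA _ (fmap F (f Y))) -fmapM -g'E fmapM (cmpA _ (fmap F g')).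
  by rewrite (restr_natural t (hN X)) -(cmpA (fmap G g')) -zE !cmpA -!fmapM g'E.
exists (NatTrans nat); apply: nattrans_eq => -[X hX] /=.
apply: (DEF_pure_mono_monic mG (pf X)).
by rewrite zE (restr_natural t hX).
Qed.

End Extension.

Theorem theorem3p9 (D C : preaddcat) (defD : definable D) (defC : definable C)
    (F G : functor D C) (mF : DEF_morphism F) (mG : DEF_morphism G)
    (tau' : nattrans (frestr F (pure_injective D)) (frestr G (pure_injective D))) :
  (exists! tau : nattrans F G, ntrestr tau (pure_injective D) = tau') /\
  (is_natiso tau' ->
     forall tau : nattrans F G, ntrestr tau (pure_injective D) = tau' -> is_natiso tau).
Proof.
split.
  have [tau tauE] := nattrans_extend defD defC mG tau'.
  exists tau; split=> // s sE.
  by apply: (nattrans_restr_inj defD defC mG); rewrite tauE sE.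
move=> iso' tau tauE.
pose inv X := sval (cid (iso' X)).
have inv1 X : inv X \c tau' X = idm _ by have [] := svalP (cid (iso' X)).
have inv2 X : tau' X \c inv X = idm _ by have [] := svalP (cid (iso' X)).
have inv_nat X Y (g : hom X Y) :
    inv Y \c fmap (frestr G (pure_injective D)) g =
    fmap (frestr F (pure_injective D)) g \c inv X.
  apply: (iso_cancell (iso' Y)); rewrite cmpA inv2 cmp1m cmpA ntN.
  by rewrite -cmpA inv2 cmpm1.
(* The inverse of [tau'] is extended with [F] and [G] exchanged. Its composites with [tau] are
   identities on pure-injectives, hence everywhere by uniqueness. *)
have [s sE] := nattrans_extend defD defC mF (NatTrans inv_nat).
have restrE (H : functor D C) (u v : nattrans H H) : DEF_morphism H ->
    (forall X : full_sub (pure_injective D), u (sval X) = v (sval X)) -> u = v.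
  move=> mH uv; apply: (nattrans_restr_inj defD defC mH).
  by apply: nattrans_eq => X; exact: uv.
have sX (X : full_sub (pure_injective D)) : s (sval X) = inv X.
  exact: (congr1 (fun u => nt u X) sE).
have tX (X : full_sub (pure_injective D)) : tau (sval X) = tau' X.
  exact: (congr1 (fun u => nt u X) tauE).
have st : nt_comp s tau = nt_id F.
  by apply: restrE => // X /=; rewrite sX tX; exact: inv1.
have ts : nt_comp tau s = nt_id G.
  by apply: restrE => // X /=; rewrite sX tX; exact: inv2.
move=> X; exists (s X); split.
  exact: (congr1 (fun u => nt u X) st).
exact: (congr1 (fun u => nt u X) ts).
Qed.
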